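(* Let $g,k\ge1$ be integers. For all $\Omega,\Omega'\in\mathbb H_g$ and $l,l'\in\mathbb Z^g/k\mathbb Z^g$, the BKS pairing is given by $$\left\langle\vartheta^l_\Omega\otimes\sqrt{d^gz_\Omega},\ \vartheta^{l'}_{\Omega'}\otimes\sqrt{d^gz_{\Omega'}}\right\rangle_{BKS}=2^{-g/2}k^{-g}\,\delta_{l,l'}.$$
   Context: $\mathbb H_g$ is the Siegel upper half-space of symmetric complex $g\times g$ matrices with positive definite imaginary part. On $\mathbb T^{2g}=\mathbb R^{2g}/\mathbb Z^{2g}$ with coordinates $(x,y)$, $x,y\in\mathbb R^g$, sections of the prequantum bundle $L^k$ are identified with functions on $\mathbb R^{2g}$ satisfying $s(x+a,y+b)=(-1)^{k\,{}^tab}e^{-k\pi i({}^tya-{}^txb)}s(x,y)$ for $a,b\in\mathbb Z^g$; the $L^2$ inner product is $\langle s,s'\rangle=\int_{[0,1]^{2g}}s\,\overline{s'}\,d^gx\,d^gy$. For $\Omega\in\mathbb H_g$ and $l\in\mathbb Z^g/k\mathbb Z^g$, $$\vartheta^l_\Omega(x,y)=e^{-k\pi i\,{}^txy}\sum_{m\in\mathbb Z^g}e^{k\pi i\,{}^t(y-m-l/k)\Omega(y-m-l/k)+2k\pi i\,{}^t(m+l/k)x},$$ which is a section of $L^k$. The half-form line over $\Omega\in\mathbb H_g$ is the complex line with generator $\sqrt{d^gz_\Omega}$ (where $z_\Omega=x-\Omega y$), and half-forms over different points are paired sesquilinearly (conjugate linear in the second argument) by $$\langle\sqrt{d^gz_\Omega},\sqrt{d^gz_{\Omega'}}\rangle=\Big(\det\tfrac1{2ki}(\Omega-\overline{\Omega'})\Big)^{1/2},$$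 with branch fixed by $\big(\det\tfrac1{2ki}(\Omega-\overline{\Omega'})\big)^{-1/2}:=\int_{\mathbb R^g}e^{-\pi\,{}^t\xi(\Omega-\overline{\Omega'})\xi/(2ki)}\,d^g\xi$. The BKS pairing is the product of the $L^2$ pairing of sections and the pairing of half-forms: $\langle s\otimes\mu,s'\otimes\mu'\rangle_{BKS}=\langle s,s'\rangle\langle\mu,\mu'\rangle$. *)

(* Defs.v *)
From HB Require Import structures.
From mathcomp Require Import all_boot all_order all_algebra.
From mathcomp Require Import complex.
From mathcomp Require Import all_classical all_reals all_analysis.
From mathcomp Require Import finmap ring.
From mathcomp Require summability.

Set Implicit Arguments.
Unset Strict Implicit.
Unset Printing Implicit Defensive.

Import Order.TTheory GRing.Theory Num.Theory.
Import numFieldNormedType.Exports.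

Local Open Scope classical_set_scope.
Local Open Scope ring_scope.

Section lebesgue_tuple.
Context (R : realType).
Local Notation mu1 :=
  (lebesgue_measure : {sigma_finite_measure set (measurableTypeR R) -> \bar R}).

Definition tcons n (p : measurableTypeR R * n.-tuple R) : n.+1.-tuple R :=
  [tuple of p.1 :: p.2].

Lemma measurable_tcons n : measurable_fun setT (@tcons n).
Proof. exact: measurable_cons. Qed.

Section step.
Context (n : nat) (mu : {sigma_finite_measure set (n.-tuple R) -> \bar R}).

Definition lebesgue_cons : set (n.+1.-tuple R) -> \bar R :=
  pushforward (mu1 \x mu)%E (@tcons n).

HB.instance Definition _ := Measure.copy lebesgue_cons
  (measure_function_pushforward__canonical__measure_function_Measure (mu1 \x mu)%E (measurable_tcons (n:=n))).

Lemma lebesgue_cons_sigma_finite : sigma_finite setT lebesgue_cons.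
Proof.
have /sigma_finiteP[F [TF ndF Foo]] := sigma_finiteT mu1.
have /sigma_finiteP[G [TG ndG Goo]] := sigma_finiteT mu.
pose h (t : n.+1.-tuple R) := (thead t, [tuple of behead t]).
have hK : cancel (@tcons n) h by case=> x t; congr pair; apply: val_inj.
have mh : measurable_fun setT h.
  apply/measurable_fun_pair; first exact: measurable_tnth.
  exact: measurable_behead.
exists (fun i => h @^-1` (F i `*` G i)).
  rewrite -preimage_bigcup [X in _ @^-1` X](_ : _ = setT) ?preimage_setT//.
  apply/seteqP; split => // -[x t] _.
  have : (\bigcup_i F i) x by rewrite -TF.
  have : (\bigcup_i G i) t by rewrite -TG.
  move=> [j _ Gjt] [i _ Fix]; exists (maxn i j) => //; split => /=.
    by move: x Fix; exact/subsetPset/ndF/leq_maxl.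
  by move: t Gjt; exact/subsetPset/ndG/leq_maxr.
move=> i; have [? ?] := Foo i; have [? ?] := Goo i; split.
  by rewrite -[X in measurable X]setTI; apply: mh => //; exact: measurableX.
rewrite /lebesgue_cons /pushforward -comp_preimage.
have -> : h \o @tcons n = id by apply/funext => p /=; exact: hK.
by rewrite preimage_id product_measure1E// lte_mul_pinfty// ge0_fin_numE.
Qed.

HB.instance Definition _ := Measure_isSigmaFinite.Build _ _ _
  lebesgue_cons lebesgue_cons_sigma_finite.
End step.

(* Lebesgue measure on R^n: product measure, transported along R * R^n = R^n.+1;
   sigma-finiteness is carried along because the product needs it *)
Fixpoint lebesgue_tuple n : {sigma_finite_measure set (n.-tuple R) -> \bar R} :=
  if n is m.+1 then lebesgue_cons (lebesgue_tuple m) else \d_ [tuple].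

End lebesgue_tuple.
Arguments lebesgue_tuple R n : clear implicits.

Lemma sumZ (K : numFieldType) (I : choiceType) (c : K) (f : I -> K^o) : c != 0 ->
  summability.sum (fun i => c *: f i) = c *: summability.sum f.
Proof.
move=> c0; rewrite /summability.sum.
have psE (e : K) (g : I -> K^o) : summability.partial_sum (fun i => e *: g i)
    = e *: summability.partial_sum g.
  by apply/funext => A; rewrite /summability.partial_sum [RHS]scaler_sumr.
have FF := @summability.totally_filter I.
rewrite psE.
have [cf|dvf] := pselect (cvg (summability.partial_sum f @ summability.totally)).
  by apply: cvg_lim; [exact: norm_hausdorff|exact: cvgZl_tmp].
rewrite (dvgP dvf) [RHS]mulr0; apply: dvgP => cvf; apply: dvf.
have := @is_cvgZl_tmp _ _ _ _ _ c^-1 _ cvf.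
by rewrite scalerA mulVf// scale1r; exact.
Qed.

Section complex_analysis.
Context (R : realType).
Local Open Scope complex_scope.

Definition expC (z : R[i]) : R[i] :=
  (expR (complex.Re z))%:C * (cos (complex.Im z) +i* sin (complex.Im z)).

Definition Cintegral d (T : measurableType d)
    (mu : {measure set T -> \bar R}) (D : set T) (f : T -> R[i]) : R[i] :=
  (\int[mu]_(x in D) complex.Re (f x)) +i* (\int[mu]_(x in D) complex.Im (f x)).

(* unordered sum: limit along the finite subsets of I *)
Definition Csum (I : choiceType) (f : I -> R[i]) : R[i] :=
  summability.sum (R := R[i]^o) f.

Lemma expC0 : expC 0 = 1.
Proof. by rewrite /expC/= expR0 cos0 sin0 mul1r. Qed.

Lemma expCD z w : expC (z + w) = expC z * expC w.
Proof.
case: z w => [a b] [c d]; rewrite /expC /= expRD cosD sinD.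
by apply/eqP; rewrite eq_complex /=; apply/andP; split; apply/eqP; ring.
Qed.

Lemma expC_neq0 z : expC z != 0.
Proof.
apply/eqP => z0; have := expC0; rewrite -(subrr z) expCD z0 mul0r => /esym/eqP.
by rewrite oner_eq0.
Qed.

Lemma expCMz z (n : int) : expC (n%:~R * z) = expC z ^ n.
Proof.
have H (m : nat) w : expC (m%:R * w) = expC w ^+ m.
  elim: m => [|m IH]; first by rewrite mul0r expC0.
  by rewrite -natr1 mulrDl mul1r expCD IH exprSr.
case: n => n; first exact: H.
apply: (mulfI (expC_neq0 (n.+1%:R * z))); rewrite -expCD NegzE mulrNz mulNr.
rewrite addrN expC0 H -exprnN exprnP.
by rewrite divff// expf_neq0// expC_neq0.
Qed.

Lemma expC_pi : expC (pi%:C * 'i) = -1.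
Proof.
rewrite /expC /= mul0r mul0r mulr1 mulr0 subrr addr0 expR0 cospi sinpi mul1r.
by apply/eqP; rewrite eq_complex /= oppr0 !eqxx.
Qed.

Lemma CsumZ (I : choiceType) (c : R[i]) (f : I -> R[i]) : c != 0 ->
  Csum (fun i => c * f i) = c * Csum f.
Proof. exact: (@sumZ R[i]). Qed.

Lemma Csum_reindex (I : choiceType) (f : I -> R[i]) (h h' : I -> I) :
  cancel h h' -> cancel h' h -> Csum (f \o h) = Csum f.
Proof.
move=> hK h'K; rewrite /Csum /summability.sum.
have psE (u v : I -> I) (e : I -> R[i]^o) (A : {fset I}) : cancel u v ->
    summability.partial_sum (e \o u) A =
    summability.partial_sum e [fset u x | x in A]%fset.
  move=> uK; rewrite /summability.partial_sum.
  rewrite -!(big_seq_fsetE _ _ xpredT)/= big_imfset//= => x y _ _.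
  exact: (can_inj uK).
have sub (u v : I -> I) (e : I -> R[i]^o) : cancel u v -> cancel v u ->
    summability.partial_sum (e \o u) @ summability.totally
    `=>` summability.partial_sum e @ summability.totally.
  move=> uK vK B [A _ AB]; exists [fset v x | x in A]%fset => // A' /= AA'.
  rewrite (psE u v)//; apply: AB => /=; apply/fsubsetP => x xA.
  apply/imfsetP; exists (v x); rewrite /= ?vK//.
  by apply: (fsubsetP AA'); apply/imfsetP; exists x.
suff -> : summability.partial_sum (f \o h : I -> R[i]^o) @ summability.totally
    = summability.partial_sum (f : I -> R[i]^o) @ summability.totally by [].
apply/seteqP; split; last exact: (sub h h').
have := sub h' h (f \o h) h'K hK.
by rewrite (_ : (f \o h) \o h' = f)//; apply/funext => x /=; rewrite h'K.
Qed.

End complex_analysis.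

Section theta.
Context (R : realType).
Local Open Scope complex_scope.

Definition dot (S : pzRingType) g (u v : 'cV[S]_g) : S := (u^T *m v) 0 0.

Definition quad g (M : 'M[R[i]]_g) (v : 'cV[R]_g) : R[i] :=
  dot (map_mx (fun r => r%:C) v) (M *m map_mx (fun r => r%:C) v).

(* the Siegel upper half-space *)
Definition siegel g (Om : 'M[R[i]]_g) : Prop :=
  Om^T = Om /\
  forall v : 'cV[R]_g, v != 0 ->
    0 < dot v (map_mx (fun z => complex.Im z) Om *m v).

Definition intv g (a : 'cV[int]_g) : 'cV[R]_g := map_mx intr a.

(* sections of the k-th power of the prequantum bundle over R^2g / Z^2g, as
   functions of (x, y) on the universal cover *)
Definition quasi_periodic g (k : nat) (s : 'cV[R]_g -> 'cV[R]_g -> R[i]) :=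
  forall (x y : 'cV[R]_g) (a b : 'cV[int]_g),
    s (x + intv a) (y + intv b) =
    (-1) ^ (k%:Z * dot a b)
    * expC (- (k%:R * pi%:C * 'i * (dot y (intv a) - dot x (intv b))%:C))
    * s x y.

Record Lk_section g k := LkSection {
  section_fun :> 'cV[R]_g -> 'cV[R]_g -> R[i];
  section_quasi_periodic : quasi_periodic k section_fun }.

(* m + l / k *)
Definition theta_shift g k (l m : 'cV[int]_g) : 'cV[R]_g :=
  intv m + k%:R^-1 *: intv l.

(* l is a representative in Z^g of a class in Z^g / k Z^g; replacing l by
   l + k a reindexes the sum by m |-> m + a *)
Definition theta_fun g k (l : 'cV[int]_g) (Om : 'M[R[i]]_g) (x y : 'cV[R]_g) :
    R[i] :=
  expC (- (k%:R * pi%:C * 'i * (dot x y)%:C)) *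
  Csum (fun m : 'cV[int]_g =>
    expC (k%:R * pi%:C * 'i * quad Om (y - theta_shift k l m)
          + 2 * k%:R * pi%:C * 'i * (dot (theta_shift k l m) x)%:C)).

Lemma dotDl (S : pzRingType) g (u u' v : 'cV[S]_g) :
  dot (u + u') v = dot u v + dot u' v.
Proof. by rewrite /dot linearD mulmxDl mxE. Qed.

Lemma dotDr (S : pzRingType) g (u v v' : 'cV[S]_g) :
  dot u (v + v') = dot u v + dot u v'.
Proof. by rewrite /dot mulmxDr mxE. Qed.

Lemma dotC (S : comPzRingType) g (u v : 'cV[S]_g) : dot u v = dot v u.
Proof. by rewrite /dot -[in RHS](trmxK u) -trmx_mul [in RHS]mxE. Qed.

Lemma dotZl (S : pzRingType) g (c : S) (u v : 'cV[S]_g) :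
  dot (c *: u) v = c * dot u v.
Proof. by rewrite /dot linearZ -scalemxAl mxE. Qed.

Lemma dot_intv g (a b : 'cV[int]_g) : dot (intv a) (intv b) = (dot a b)%:~R.
Proof. by rewrite /dot /intv map_trmx -map_mxM mxE. Qed.

Lemma expC_pi_int (n : int) : expC (n%:~R * (pi%:C * 'i)) = (-1) ^ n :> R[i].
Proof. by rewrite expCMz expC_pi. Qed.

Lemma expC_2pi_int (n : int) : expC (2 * n%:~R * (pi%:C * 'i)) = 1 :> R[i].
Proof.
have -> : 2 * n%:~R * (pi%:C * 'i) = n%:~R * (pi%:C * 'i + pi%:C * 'i) :> R[i].
  by ring.
by rewrite expCMz expCD expC_pi mulrNN mulr1 exp1rz.
Qed.

Lemma expC_mod (n : int) (z w : R[i]) :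
  z = 2 * n%:~R * (pi%:C * 'i) + w -> expC z = expC w.
Proof. by move=> ->; rewrite expCD expC_2pi_int mul1r. Qed.

Lemma theta_shift_dot_int g k (l m a : 'cV[int]_g) :
  exists n : int, k%:R * dot (theta_shift k l m) (intv a) = n%:~R.
Proof.
exists (k%:Z * dot m a + (k != 0)%:Z * dot l a).
rewrite /theta_shift dotDl dotZl !dot_intv mulrDr mulrA rmorphD !rmorphM/=.
have [->|k0] := eqVneq k 0%N; first by rewrite !mul0r.
by rewrite divff ?pnatr_eq0.
Qed.

Lemma theta_quasi_periodic g k (l : 'cV[int]_g) (Om : 'M[R[i]]_g) :
  quasi_periodic k (theta_fun k l Om).
Proof.
move=> x y a b; rewrite /theta_fun.
set F := (fun m : 'cV[int]_g => expC (_ + 2 * _ * _ * _ * (dot _ x)%:C)).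
have realCD (r s : R) : (r + s)%:C = r%:C + s%:C by rewrite rmorphD.
have realCN (r : R) : (- r)%:C = - r%:C by rewrite rmorphN.
have realCM (r s : R) : (r * s)%:C = r%:C * s%:C by rewrite rmorphM.
have realCz (n : int) : (n%:~R : R)%:C = n%:~R by rewrite rmorph_int.
have realCn (n : nat) : (n%:R : R)%:C = n%:R by rewrite rmorph_nat.
rewrite -(@Csum_reindex _ _ _ (+%R b) (fun m => m - b)); last 2 first.
- by move=> m; rewrite addrC addKr.
- by move=> m; rewrite addrC subrK.
rewrite [X in Csum X](_ : _ = fun m =>
    expC (2 * k%:R * pi%:C * 'i * (dot (intv b) x)%:C) * F m); last first.
  apply/funext => m; rewrite /= /F -expCD.
  have -> : theta_shift k l (b + m) = intv b + theta_shift k l m.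
    by rewrite /theta_shift /intv map_mxD addrA.
  have -> : y + intv b - (intv b + theta_shift k l m) = y - theta_shift k l m.
    by rewrite opprD addrA addrK.
  have [n kn] := theta_shift_dot_int k l m a.
  rewrite dotDl !dotDr dot_intv.
  apply: (@expC_mod (k%:Z * dot b a + n)).
  have := congr1 (fun r => r%:C) kn; rewrite realCM realCz realCn => knC.
  rewrite intrD intrM -knC !realCD realCz -pmulrn; ring.
rewrite CsumZ ?expC_neq0// [LHS]mulrA [RHS]mulrA; congr (_ * _).
rewrite -expC_pi_int -!expCD.
apply: (@expC_mod (- (k%:Z * dot a b))).
rewrite !dotDl !dotDr dot_intv !realCD realCN realCz.
rewrite (dotC (intv b) x) (dotC (intv a) y) !mulrNz !intrM -!pmulrn; ring.
Qed.

Definition theta g k (l : 'cV[int]_g) (Om : 'M[R[i]]_g) : Lk_section g k :=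
  LkSection (theta_quasi_periodic k l Om).

End theta.

Section pairing.
Context (R : realType).
Local Open Scope complex_scope.

Definition colv n (t : n.-tuple R) : 'cV[R]_n := \col_i tnth t i.

Definition unit_cube n : set (n.-tuple R) :=
  [set t | forall i, tnth t i \in `[0, 1]].
Arguments unit_cube n : clear implicits.

Definition L2_pairing g k (s s' : Lk_section R g k) : R[i] :=
  Cintegral (lebesgue_tuple R g \x lebesgue_tuple R g)%E
    (unit_cube g `*` unit_cube g)
    (fun p => s (colv p.1) (colv p.2) * (s' (colv p.1) (colv p.2))^*).

(* the complex line with generator sqrt_dz Om; half_form_coef is the coordinate
   with respect to this generator *)
Record half_form g (Om : 'M[R[i]]_g) := HalfForm { half_form_coef : R[i] }.

Definition sqrt_dz g (Om : 'M[R[i]]_g) : half_form Om := HalfForm Om 1.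

Definition gaussian_integral g (M : 'M[R[i]]_g) : R[i] :=
  Cintegral (lebesgue_tuple R g) setT
    (fun xi => expC (- (pi%:C * quad M (colv xi)))).

(* the square root of det M whose inverse is the Gaussian integral: for M
   symmetric with positive definite real part the latter is a square root of
   (det M)^-1, so that the default value 0 is not reached *)
Definition sqrt_det g (M : 'M[R[i]]_g) : R[i] :=
  xget 0 [set d : R[i] | d ^+ 2 = \det M /\ d^-1 = gaussian_integral M].

Definition half_form_pairing g k (Om Om' : 'M[R[i]]_g)
    (mu : half_form Om) (mu' : half_form Om') : R[i] :=
  half_form_coef mu * (half_form_coef mu')^* *
  sqrt_det ((2 * k%:R * 'i)^-1 *: (Om - map_mx conjc Om')).

(* on simple tensors s (x) mu, represented by the pairs (s, mu) *)
Definition BKS_pairing g k (Om Om' : 'M[R[i]]_g)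
    (t : Lk_section R g k * half_form Om)
    (t' : Lk_section R g k * half_form Om') : R[i] :=
  L2_pairing t.1 t'.1 * half_form_pairing k t.2 t'.2.

End pairing.

(* Main.v *)
Require Import Defs.
From HB Require Import structures.
From mathcomp Require Import all_boot all_order all_algebra.
From mathcomp Require Import complex.
From mathcomp Require Import all_classical all_reals all_analysis.
From mathcomp Require Import finmap ring lra measurable_realfun.
From mathcomp Require summability.

Set Implicit Arguments.
Unset Strict Implicit.
Unset Printing Implicit Defensive.

Import Order.TTheory GRing.Theory Num.Theory.
Import numFieldNormedType.Exports.
Import Normc.

Local Open Scope classical_set_scope.
Local Open Scope ring_scope.
Local Open Scope complex_scope.

(** Multiply the theta series of [Om] and [l] by the conjugate of that of [Om']
    and [l'].  The prefactors have modulus 1 and cancel, and the terms of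
    indices m and m' multiply to a character of x, of frequency
    k (m - m') + (l - l'), times a Gaussian in y.  Integration over x kills the
    pairs with nonzero frequency ([Cintegral_character_cube]).  If l and l' are
    not congruent modulo k, nothing remains.  Otherwise one may take l' = l,
    since the sum over m only depends on the class of l; then the diagonal
    m = m' remains, and the integrals over the unit cube of the translates of
    one Gaussian by the integer lattice add up to its integral over R^g
    ([Cintegral_unfold]).  This Gaussian has the matrix
    - k i (Om - conj Om') = 2 k^2 M, where M is the matrix of the half-form
    pairing, so the substitution y = xi / (sqrt 2 k) produces the factor
    2^(-g/2) k^(-g) and the Gaussian integral of M, which the half-form factor
    cancels.

    Sum and integral are exchanged in [L2_pairing_theta_limit] by dominated
    convergence along finite partial sums: on the unit cube these are bounded
    uniformly, by comparison of the Gaussians with geometric series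
    ([lattice_gauss_bound]).

    The remaining point is that the Gaussian integral of M is a square root of
    1 / det M when M is symmetric with positive definite real part
    ([gaussian_integralE]).  Completing the square in one variable leaves the
    Schur complement, which is again of this kind ([re_posdef_schur]), and a
    one-variable integral of exp (- pi (c t + w)^2) with |Im c| < Re c.  That
    integral is 1 / c, because the contour t |-> c t + w may be deformed into
    the real line inside the sectors where exp (- pi z^2) decays
    ([complex_gaussian_integral]). *)

(** * Complex numbers *)

Section complex_numbers.
Context (R : realType).
Implicit Types z w : R[i].

Lemma ReD z w : complex.Re (z + w) = complex.Re z + complex.Re w.
Proof. by case: z w => [a b] [c d]. Qed.

Lemma ImD z w : complex.Im (z + w) = complex.Im z + complex.Im w.
Proof. by case: z w => [a b] [c d]. Qed.

Lemma ReN z : complex.Re (- z) = - complex.Re z.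
Proof. by case: z. Qed.

Lemma ImN z : complex.Im (- z) = - complex.Im z.
Proof. by case: z. Qed.

Lemma ReM z w : complex.Re (z * w) =
  complex.Re z * complex.Re w - complex.Im z * complex.Im w.
Proof. by case: z w => [a b] [c d]. Qed.

Lemma ImM z w : complex.Im (z * w) =
  complex.Re z * complex.Im w + complex.Im z * complex.Re w.
Proof. by case: z w => [a b] [c d]. Qed.

Lemma realCD (r s : R) : (r + s)%:C = r%:C + s%:C.
Proof. by rewrite rmorphD. Qed.

Lemma realCN (r : R) : (- r)%:C = - r%:C.
Proof. by rewrite rmorphN. Qed.

Lemma realCM (r s : R) : (r * s)%:C = r%:C * s%:C.
Proof. by rewrite rmorphM. Qed.

Lemma conjcM z w : conjc (z * w) = conjc z * conjc w.
Proof. exact: rmorphM. Qed.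

Lemma conjcN z : conjc (- z) = - conjc z.
Proof. exact: rmorphN. Qed.

Lemma conjc_sum (I : Type) (r : seq I) (P : pred I) (F : I -> R[i]) :
  conjc (\sum_(i <- r | P i) F i) = \sum_(i <- r | P i) conjc (F i).
Proof. exact: rmorph_sum. Qed.

Lemma Re_sum (I : Type) (r : seq I) (P : pred I) (F : I -> R[i]) :
  complex.Re (\sum_(i <- r | P i) F i) = \sum_(i <- r | P i) complex.Re (F i).
Proof. by elim/big_rec2: _ => // i x y _ <-; rewrite ReD. Qed.

Lemma Im_sum (I : Type) (r : seq I) (P : pred I) (F : I -> R[i]) :
  complex.Im (\sum_(i <- r | P i) F i) = \sum_(i <- r | P i) complex.Im (F i).
Proof. by elim/big_rec2: _ => // i x y _ <-; rewrite ImD. Qed.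

Lemma complex_ext z w :
  complex.Re z = complex.Re w -> complex.Im z = complex.Im w -> z = w.
Proof. by case: z w => [a b] [c d] /= -> ->. Qed.

Lemma normc_ge0 z : 0 <= normc z.
Proof. by case: z => a b; exact: sqrtr_ge0. Qed.

Lemma normcR (r : R) : normc r%:C = `|r|.
Proof. by rewrite /= expr0n addr0 sqrtr_sqr. Qed.

Lemma normc_conjc z : normc (conjc z) = normc z.
Proof. by case: z => a b /=; rewrite sqrrN. Qed.

Lemma Re_le_normc z : `|complex.Re z| <= normc z.
Proof.
by case: z => a b /=; rewrite -sqrtr_sqr ler_wsqrtr// lerDl sqr_ge0.
Qed.

Lemma Im_le_normc z : `|complex.Im z| <= normc z.
Proof.
by case: z => a b /=; rewrite -sqrtr_sqr ler_wsqrtr// lerDr sqr_ge0.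
Qed.

Lemma normc_le_ReIm z : normc z <= `|complex.Re z| + `|complex.Im z|.
Proof.
rewrite {1}(complexE z) (le_trans (le_normcD _ _))// normcM !normcR lerD2l.
by rewrite /= expr0n add0r expr1n sqrtr1 mul1r.
Qed.

Lemma normc_sum (I : Type) (r : seq I) (P : pred I) (F : I -> R[i]) :
  normc (\sum_(i <- r | P i) F i) <= \sum_(i <- r | P i) normc (F i).
Proof.
elim/big_ind2: _ => [|x1 x2 y1 y2 h1 h2|//]; first by rewrite normc0.
by rewrite (le_trans (le_normcD _ _))// lerD.
Qed.

Lemma normc_expC z : normc (expC z) = expR (complex.Re z).
Proof.
rewrite /expC normcM normcR /= cos2Dsin2 sqrtr1 mulr1.
by rewrite ger0_norm// expR_ge0.
Qed.

Lemma expC_real (r : R) : expC r%:C = (expR r)%:C.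
Proof. by rewrite /expC/= cos0 sin0 mulr1. Qed.

Lemma expCJ z : conjc (expC z) = expC (conjc z).
Proof.
case: z => a b; rewrite /expC /= cosN sinN.
by apply: complex_ext => /=; ring.
Qed.

End complex_numbers.

(** * Complex-valued functions of a real variable *)

Section complex_derivative.
Context (R : realType).
Implicit Types (f g : R -> R[i]) (x : R).

(** The complex numbers are a normed space over themselves only, so that
    differentiation in a real variable goes through the two coordinates. *)
Definition Cderiv f x (d : R[i]) :=
  is_derive x 1 (fun t => complex.Re (f t)) (complex.Re d) /\
  is_derive x 1 (fun t => complex.Im (f t)) (complex.Im d).

Lemma Cderiv_cst (c : R[i]) x : Cderiv (fun=> c) x 0.
Proof. by split; exact: is_derive_cst. Qed.

Lemma Cderiv_real x : Cderiv (fun t => t%:C) x 1.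
Proof. by split=> /=; [exact: is_derive_id|exact: is_derive_cst]. Qed.

Lemma CderivD f g x a b : Cderiv f x a -> Cderiv g x b ->
  Cderiv (fun t => f t + g t) x (a + b).
Proof.
move=> [f1 f2] [g1 g2]; split; rewrite ?ReD ?ImD.
  under eq_fun do rewrite ReD; exact: is_deriveD.
by under eq_fun do rewrite ImD; exact: is_deriveD.
Qed.

Lemma CderivM f g x a b : Cderiv f x a -> Cderiv g x b ->
  Cderiv (fun t => f t * g t) x (a * g x + f x * b).
Proof.
move=> [f1 f2] [g1 g2]; split.
  under eq_fun do rewrite ReM.
  apply: (is_derive_eq (is_deriveB (is_deriveM f1 g1) (is_deriveM f2 g2))).
  by rewrite !ReD !ReM /GRing.scale/=; ring.
under eq_fun do rewrite ImM.
apply: (is_derive_eq (is_deriveD (is_deriveM f1 g2) (is_deriveM f2 g1))).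
by rewrite !ImD !ImM /GRing.scale/=; ring.
Qed.

Lemma Cderiv_expC f x a : Cderiv f x a ->
  Cderiv (fun t => expC (f t)) x (a * expC (f x)).
Proof.
move=> [f1 f2].
have e1 := is_derive1_comp (is_derive_expR _) f1.
have c1 := is_derive1_comp (is_derive_cos _) f2.
have s1 := is_derive1_comp (is_derive_sin _) f2.
split.
  rewrite [X in is_derive _ _ X _](_ : _ = fun t =>
    expR (complex.Re (f t)) * cos (complex.Im (f t))); last first.
    by apply/funext => t; rewrite /expC ReM /= mul0r subr0.
  apply: (is_derive_eq (is_deriveM e1 c1)).
  by rewrite /expC !ReM ImM /GRing.scale/=; ring.
rewrite [X in is_derive _ _ X _](_ : _ = fun t =>
  expR (complex.Re (f t)) * sin (complex.Im (f t))); last first.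
  by apply/funext => t; rewrite /expC ImM /= mul0r addr0.
apply: (is_derive_eq (is_deriveM e1 s1)).
by rewrite /expC !ImM ReM /GRing.scale/=; ring.
Qed.

Lemma Cderiv_eq f x a b : Cderiv f x a -> a = b -> Cderiv f x b.
Proof. by move=> + <-. Qed.

End complex_derivative.

(** * Complex-valued Lebesgue integrals *)

Section complex_integral.
Context d (T : measurableType d) (R : realType).
Implicit Types (mu : {measure set T -> \bar R}) (D : set T) (f g : T -> R[i]).

Definition Cmeasurable D f :=
  measurable_fun D (fun x => complex.Re (f x)) /\
  measurable_fun D (fun x => complex.Im (f x)).

Definition Cintegrable mu D f :=
  mu.-integrable D (fun x => (complex.Re (f x))%:E) /\
  mu.-integrable D (fun x => (complex.Im (f x))%:E).

Lemma Cmeasurable_cst D (c : R[i]) : Cmeasurable D (fun=> c).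
Proof. by split; exact: measurable_cst. Qed.

Lemma Cmeasurable_real D (f : T -> R) :
  measurable_fun D f -> Cmeasurable D (fun x => (f x)%:C).
Proof. by move=> mf; split => //=; exact: measurable_cst. Qed.

Lemma CmeasurableD D f g : Cmeasurable D f -> Cmeasurable D g ->
  Cmeasurable D (fun x => f x + g x).
Proof.
move=> [f1 f2] [g1 g2]; split.
  by under eq_fun do rewrite ReD; exact: measurable_funD.
by under eq_fun do rewrite ImD; exact: measurable_funD.
Qed.

Lemma CmeasurableN D f : Cmeasurable D f -> Cmeasurable D (fun x => - f x).
Proof.
move=> [f1 f2]; split.
  by under eq_fun do rewrite ReN; exact: measurableT_comp.
by under eq_fun do rewrite ImN; exact: measurableT_comp.
Qed.

Lemma CmeasurableM D f g : Cmeasurable D f -> Cmeasurable D g ->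
  Cmeasurable D (fun x => f x * g x).
Proof.
move=> [f1 f2] [g1 g2]; split.
  by under eq_fun do rewrite ReM; apply: measurable_funB; exact: measurable_funM.
by under eq_fun do rewrite ImM; apply: measurable_funD; exact: measurable_funM.
Qed.

Lemma CmeasurableJ D f : Cmeasurable D f -> Cmeasurable D (fun x => conjc (f x)).
Proof.
move=> [f1 f2]; split.
  rewrite (_ : (fun x => _) = fun x => complex.Re (f x))//.
  by apply/funext => x; case: (f x).
rewrite (_ : (fun x => _) = fun x => - complex.Im (f x)).
  exact: measurableT_comp.
by apply/funext => x; case: (f x).
Qed.

Lemma Cmeasurable_sum D (I : Type) (s : seq I) (h : I -> T -> R[i]) :
  (forall i, Cmeasurable D (h i)) -> Cmeasurable D (fun x => \sum_(i <- s) h i x).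
Proof.
move=> mh; split.
  under eq_fun do rewrite Re_sum.
  by apply: measurable_sum => i; have [] := mh i.
under eq_fun do rewrite Im_sum.
by apply: measurable_sum => i; have [] := mh i.
Qed.

Lemma Cmeasurable_expC D f :
  Cmeasurable D f -> Cmeasurable D (fun x => expC (f x)).
Proof.
move=> [f1 f2].
have mcos : measurable_fun D (fun x => cos (complex.Im (f x))).
  apply: measurableT_comp f2; apply: continuous_measurable_fun.
  exact: continuous_cos.
have msin : measurable_fun D (fun x => sin (complex.Im (f x))).
  apply: measurableT_comp f2; apply: continuous_measurable_fun.
  exact: continuous_sin.
have mexp : measurable_fun D (fun x => expR (complex.Re (f x))).
  exact: measurableT_comp.
by apply: CmeasurableM; [exact: Cmeasurable_real|split].
Qed.

Lemma Cintegrable_measurable mu D f : Cintegrable mu D f -> Cmeasurable D f.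
Proof.
by move=> [/measurable_int/measurable_EFinP ? /measurable_int/measurable_EFinP].
Qed.

Lemma Cintegrable_le mu D f (G : T -> R) : measurable D -> Cmeasurable D f ->
  mu.-integrable D (EFin \o G) -> (forall x, D x -> normc (f x) <= G x) ->
  Cintegrable mu D f.
Proof.
move=> mD [f1 f2] iG fG; split.
  apply: (le_integrable mD _ _ iG) => [|x Dx]; first exact/measurable_EFinP.
  rewrite /= lee_fin (le_trans (Re_le_normc _))// (le_trans (fG _ Dx))//.
  exact: ler_norm.
apply: (le_integrable mD _ _ iG) => [|x Dx]; first exact/measurable_EFinP.
rewrite /= lee_fin (le_trans (Im_le_normc _))// (le_trans (fG _ Dx))//.
exact: ler_norm.
Qed.

Lemma integrable_normc mu D f : measurable D -> Cintegrable mu D f ->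
  mu.-integrable D (fun x => (normc (f x))%:E).
Proof.
move=> mD fi; have [f1 f2] := fi.
have [m1 m2] := Cintegrable_measurable fi.
have := integrableD mD (integrable_abse f1) (integrable_abse f2).
apply: le_integrable => // [|x Dx].
  apply/measurable_EFinP.
  rewrite (_ : (fun x => _) = fun x =>
    Num.sqrt (complex.Re (f x) ^+ 2 + complex.Im (f x) ^+ 2)).
    have ms : measurable_fun setT (@Num.sqrt R).
      by apply: continuous_measurable_fun; exact: sqrt_continuous.
    apply: (measurableT_comp ms).
    by apply: measurable_funD; exact: measurable_funX.
  by apply/funext => x; case: (f x).
rewrite /= lee_fin [leLHS]ger0_norm ?normc_ge0// [leRHS]ger0_norm ?addr_ge0//.
exact: normc_le_ReIm.
Qed.

Lemma CintegrableM mu D c f : measurable D -> Cintegrable mu D f ->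
  Cintegrable mu D (fun x => c * f x).
Proof.
move=> mD fi; have := integrable_normc mD fi.
move=> /(integrableZl mD (normc c)) ifc.
apply: (Cintegrable_le mD _ ifc) => [|x _]; last by rewrite normcM.
by apply: CmeasurableM; [exact: Cmeasurable_cst|exact: Cintegrable_measurable fi].
Qed.

Lemma CintegrableD mu D f g : measurable D -> Cintegrable mu D f ->
  Cintegrable mu D g -> Cintegrable mu D (fun x => f x + g x).
Proof.
move=> mD [f1 f2] [g1 g2]; split.
  by under eq_fun do rewrite ReD EFinD; exact: integrableD.
by under eq_fun do rewrite ImD EFinD; exact: integrableD.
Qed.

Lemma eq_Cintegral mu D f g : (forall x, D x -> f x = g x) ->
  Cintegral mu D f = Cintegral mu D g.
Proof.
by move=> fg; apply: complex_ext; apply: eq_Rintegral => x /set_mem /fg ->.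
Qed.

Lemma CintegralD mu D f g : measurable D -> Cintegrable mu D f ->
  Cintegrable mu D g ->
  Cintegral mu D (fun x => f x + g x) = Cintegral mu D f + Cintegral mu D g.
Proof.
move=> mD [f1 f2] [g1 g2]; apply: complex_ext; rewrite ?ReD ?ImD /=.
  by under eq_Rintegral do rewrite ReD; exact: RintegralD.
by under eq_Rintegral do rewrite ImD; exact: RintegralD.
Qed.

Lemma integrable_scale mu D (k : R) (h : T -> R) : measurable D ->
  mu.-integrable D (EFin \o h) -> mu.-integrable D (EFin \o (fun x => k * h x)).
Proof. by move=> mD /(integrableZl mD k); exact: eq_integrable. Qed.

Lemma CintegralZ mu D c f : measurable D -> Cintegrable mu D f ->
  Cintegral mu D (fun x => c * f x) = c * Cintegral mu D f.
Proof.
move=> mD [f1 f2]; apply: complex_ext; rewrite ?ReM ?ImM /=.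
  under eq_Rintegral do rewrite ReM.
  rewrite -!RintegralZl// RintegralB//; exact: integrable_scale.
under eq_Rintegral do rewrite ImM.
rewrite -!RintegralZl// RintegralD//; exact: integrable_scale.
Qed.

Lemma Cintegral0 mu D : Cintegral mu D (fun=> 0) = 0.
Proof. by apply: complex_ext => /=; rewrite /Rintegral integral0. Qed.

(** Unlike in [CintegralZ], the scalar, being 0 or 1, comes out of the integral
    even when the latter is a default value. *)
Lemma Cintegral_indicZ mu D (U : Type) (A : set U) (u : U) f :
  Cintegral mu D (fun x => (\1_A u)%:C * f x) = (\1_A u)%:C * Cintegral mu D f.
Proof.
rewrite indicE; case: (u \in A); rewrite /= ?mul1r ?mul0r.
  by apply: eq_Cintegral => x _; rewrite mul1r.
rewrite -[RHS](Cintegral0 mu D).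
by apply: eq_Cintegral => x _; rewrite mul0r.
Qed.

Lemma Cintegral_sum mu D (I : Type) (s : seq I) (h : I -> T -> R[i]) :
  measurable D -> (forall i, Cintegrable mu D (h i)) ->
  Cintegrable mu D (fun x => \sum_(i <- s) h i x) /\
  Cintegral mu D (fun x => \sum_(i <- s) h i x) =
  \sum_(i <- s) Cintegral mu D (h i).
Proof.
move=> mD ih; elim: s => [|i s [IH1 IH2]].
  have -> : (fun x => \sum_(i <- [::]) h i x) = fun=> 0.
    by apply/funext => x; rewrite big_nil.
  by rewrite big_nil Cintegral0; split => //; split; exact: integrable0.
have -> : (fun x => \sum_(i <- i :: s) h i x) =
    fun x => h i x + \sum_(i <- s) h i x.
  by apply/funext => x; rewrite big_cons.
rewrite big_cons -IH2; split; first exact: CintegrableD.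
exact: CintegralD.
Qed.

Lemma Cintegral_mkcond mu D f :
  Cintegral mu D f = Cintegral mu setT (fun x => (\1_D x)%:C * f x).
Proof.
apply: complex_ext; rewrite /= Rintegral_mkcond; apply: eq_Rintegral => x _.
  by rewrite patch_indic ReM /=; ring.
by rewrite patch_indic ImM /=; ring.
Qed.

Lemma Cintegrable_mkcond mu D f : measurable D ->
  Cintegrable mu D f <-> Cintegrable mu setT (fun x => (\1_D x)%:C * f x).
Proof.
move=> mD; rewrite /Cintegrable !(integrable_mkcond _ mD).
rewrite [X in _.-integrable setT X /\ _ <-> _](_ : _ = fun x =>
  (complex.Re ((\1_D x)%:C * f x))%:E); last first.
  by apply/funext => x; rewrite epatch_indic ReM /= -EFinM; congr EFin; ring.
rewrite [X in _ /\ _.-integrable setT X <-> _](_ : _ = fun x =>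
  (complex.Im ((\1_D x)%:C * f x))%:E)//.
by apply/funext => x; rewrite epatch_indic ImM /= -EFinM; congr EFin; ring.
Qed.

(** The factor 2 comes from bounding the real and imaginary parts separately. *)
Lemma normc_Cintegral_le mu D f K : measurable D -> (mu D < +oo)%E ->
  Cmeasurable D f -> (forall x, D x -> normc (f x) <= K) ->
  Cintegrable mu D f /\ normc (Cintegral mu D f) <= 2 * (K * fine (mu D)).
Proof.
move=> mD muD mf fK.
have iK : mu.-integrable D (EFin \o (fun=> K)).
  apply: measurable_bounded_integrable => //.
  by exists `|K|; split => // x Kx y _ /=; rewrite ltW.
have fi := Cintegrable_le mD mf iK fK; split => //.
have [f1 f2] := fi.
have key (p : R[i] -> R) : (forall z, `|p z| <= normc z) ->
    mu.-integrable D (fun x => (p (f x))%:E) ->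
    `|\int[mu]_(x in D) p (f x)|%R <= K * fine (mu D).
  move=> pn ip; rewrite (le_trans (le_normr_Rintegral _ _))//.
  rewrite -Rintegral_cst//; apply: le_Rintegral => //.
    exact: (integrable_norm ip).
  by move=> x Dx; rewrite (le_trans (pn _)) ?fK.
rewrite (le_trans (normc_le_ReIm _))// mulr_natl mulr2n lerD//=.
  by apply: key => //; exact: Re_le_normc.
by apply: key => //; exact: Im_le_normc.
Qed.

End complex_integral.

Section complex_limit.
Context (R : realType).
Implicit Types (u v : nat -> R[i]) (a b : R[i]).

Definition Ccvg u a :=
  ((fun n => complex.Re (u n)) @ \oo --> complex.Re a) /\
  ((fun n => complex.Im (u n)) @ \oo --> complex.Im a).

Lemma Ccvg_unique u a b : Ccvg u a -> Ccvg u b -> a = b.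
Proof.
move=> [a1 a2] [b1 b2].
by apply: complex_ext; [move: a1 b1|move: a2 b2]; apply: cvg_unique.
Qed.

Lemma Ccvg_cst a : Ccvg (fun=> a) a.
Proof. by split; exact: cvg_cst. Qed.

Lemma CcvgB u v a b : Ccvg u a -> Ccvg v b -> Ccvg (fun n => u n - v n) (a - b).
Proof.
move=> [a1 a2] [b1 b2]; split.
  by under eq_fun do rewrite ReD ReN; rewrite ReD ReN; exact: cvgB.
by under eq_fun do rewrite ImD ImN; rewrite ImD ImN; exact: cvgB.
Qed.

Lemma CcvgM u v a b : Ccvg u a -> Ccvg v b ->
  Ccvg (fun n => u n * v n) (a * b).
Proof.
move=> [a1 a2] [b1 b2]; split.
  by under eq_fun do rewrite ReM; rewrite ReM; apply: cvgB; exact: cvgM.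
by under eq_fun do rewrite ImM; rewrite ImM; apply: cvgD; exact: cvgM.
Qed.

Lemma CcvgJ u a : Ccvg u a -> Ccvg (fun n => conjc (u n)) (conjc a).
Proof.
have E z : complex.Im (conjc z : R[i]) = - complex.Im z by case: z.
have F z : complex.Re (conjc z : R[i]) = complex.Re z by case: z.
move=> [a1 a2]; split.
  by under eq_fun do rewrite F; rewrite F.
by under eq_fun do rewrite E; rewrite E; exact: cvgN.
Qed.

Lemma Ccvg_norm u a (e : nat -> R) : e n @[n --> \oo] --> 0 ->
  (forall n, normc (u n - a) <= e n) -> Ccvg u a.
Proof.
move=> e0 ue.
have key (p : R[i] -> R) : (forall z, `|p z| <= normc z) ->
    (forall z w, p (z - w) = p z - p w) -> p (u n) @[n --> \oo] --> p a.
  move=> pn pB; apply/subr_cvg0; apply: norm_cvg0.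
  apply: (squeeze_cvgr _ (cvg_cst 0) e0).
  by apply: nearW => n; rewrite normr_ge0 /= (le_trans _ (ue n))// -pB.
split; apply: key.
- exact: Re_le_normc.
- by move=> z w; rewrite ReD ReN.
- exact: Im_le_normc.
- by move=> z w; rewrite ImD ImN.
Qed.

Lemma Cdominated_convergence d (T : measurableType d)
    (mu : {measure set T -> \bar R}) (D : set T) (f_ : nat -> T -> R[i])
    (f : T -> R[i]) (G : T -> R) : measurable D ->
  (forall n, Cmeasurable D (f_ n)) -> mu.-integrable D (EFin \o G) ->
  (forall n x, D x -> normc (f_ n x) <= G x) ->
  (forall x, D x -> Ccvg (f_ ^~ x) (f x)) ->
  Cintegrable mu D f /\
  Ccvg (fun n => Cintegral mu D (f_ n)) (Cintegral mu D f).
Proof.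
move=> mD mf iG fG ff.
have key (p : R[i] -> R) : (forall n, measurable_fun D (fun x => p (f_ n x))) ->
   (forall z, `|p z| <= normc z) ->
   (forall x, D x -> p (f_ n x) @[n --> \oo] --> p (f x)) ->
   mu.-integrable D (fun x => (p (f x))%:E) /\
   (fun n => \int[mu]_(x in D) p (f_ n x))%R @ \oo -->
     (\int[mu]_(x in D) p (f x))%R.
  move=> mp pn pf.
  have cf x : D x -> (fun n => (p (f_ n x))%:E) @ \oo --> (p (f x))%:E.
    by move=> Dx; apply: cvg_EFin; [exact: nearW|exact: pf].
  have mpf : measurable_fun D (fun x => (p (f x))%:E).
    apply: emeasurable_fun_cvg cf => n; exact/measurable_EFinP/mp.
  have [||ipf _ cpf] := @dominated_convergence _ _ _ mu _ mD
    (fun n x => (p (f_ n x))%:E) (fun x => (p (f x))%:E) (EFin \o G) _ mpf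
    (aeW _ cf) iG.
  - by move=> n; exact/measurable_EFinP/mp.
  - apply: aeW => x n Dx; rewrite /= lee_fin (le_trans (pn _))//; exact: fG.
  split => //; apply: fine_cvg; rewrite fineK//; exact: integrable_fin_num.
have [||r1 r2] := key (@complex.Re R) _ (@Re_le_normc R).
- by move=> n; have [] := mf n.
- by move=> x Dx; have [] := ff x Dx.
have [||i1 i2] := key (@complex.Im R) _ (@Im_le_normc R).
- by move=> n; have [] := mf n.
- by move=> x Dx; have [] := ff x Dx.
by [].
Qed.

End complex_limit.

Lemma Cmeasurable_comp d d' (T : measurableType d) (T' : measurableType d')
    (R : realType) (f : T' -> R[i]) (phi : T -> T') :
  Cmeasurable setT f -> measurable_fun setT phi ->
  Cmeasurable setT (fun x => f (phi x)).
Proof.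
move=> [f1 f2] mphi.
by split; [exact: (measurableT_comp f1)|exact: (measurableT_comp f2)].
Qed.

Lemma indic_setX (T1 T2 : Type) (R : pzRingType) (A : set T1) (B : set T2) z :
  \1_(A `*` B) z = \1_A z.1 * \1_B z.2 :> R.
Proof. by rewrite !indicE in_setX -mulnb natrM. Qed.

Section complex_fubini.
Context d1 d2 (T1 : measurableType d1) (T2 : measurableType d2) (R : realType).
Context (m1 : {sigma_finite_measure set T1 -> \bar R}).
Context (m2 : {sigma_finite_measure set T2 -> \bar R}).

(** The inner integral is finite only for almost all [y]; elsewhere its default
    value differs from the extended real one, on a negligible set. *)
Lemma Rintegral_fubini (f : T1 * T2 -> R) :
  (m1 \x m2)%E.-integrable setT (EFin \o f) ->
  (\int[(m1 \x m2)%E]_z f z = \int[m2]_y \int[m1]_x f (x, y))%R.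
Proof.
move=> fi; rewrite /Rintegral -(integral21_prod_meas1 fi); congr fine.
apply: ae_eq_integral => //.
- exact: (measurable_fubini_G fi).
- apply/measurable_EFinP; apply: measurableT_comp => //.
  exact: (measurable_fubini_G fi).
- have := ae_integrable2 fi; apply: filterS => y iy _.
  by rewrite /fubini_G fineK// integrable_fin_num.
Qed.

Lemma Rintegral_fubini_left (f : T1 * T2 -> R) :
  (m1 \x m2)%E.-integrable setT (EFin \o f) ->
  (\int[(m1 \x m2)%E]_z f z = \int[m1]_x \int[m2]_y f (x, y))%R.
Proof.
move=> fi; rewrite /Rintegral -(integral12_prod_meas1 fi); congr fine.
apply: ae_eq_integral => //.
- exact: (measurable_fubini_F fi).
- apply/measurable_EFinP; apply: measurableT_comp => //.
  exact: (measurable_fubini_F fi).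
- have := ae_integrable1 fi; apply: filterS => x ix _.
  by rewrite /fubini_F fineK// integrable_fin_num.
Qed.

Lemma Cfubini (f : T1 * T2 -> R[i]) : Cintegrable (m1 \x m2)%E setT f ->
  Cintegral (m1 \x m2)%E setT f =
  Cintegral m2 setT (fun y => Cintegral m1 setT (fun x => f (x, y))).
Proof.
by move=> [f1 f2]; apply: complex_ext; rewrite /= Rintegral_fubini.
Qed.

Lemma Cfubini_swap (f : T1 * T2 -> R[i]) : Cintegrable (m1 \x m2)%E setT f ->
  Cintegral m1 setT (fun x => Cintegral m2 setT (fun y => f (x, y))) =
  Cintegral m2 setT (fun y => Cintegral m1 setT (fun x => f (x, y))).
Proof.
move=> fi; rewrite -Cfubini//; have [f1 f2] := fi.
by apply: complex_ext; rewrite /= Rintegral_fubini_left.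
Qed.

Lemma integrable_prod (F : T1 -> R) (G : T2 -> R) :
  m1.-integrable setT (EFin \o F) -> m2.-integrable setT (EFin \o G) ->
  (m1 \x m2)%E.-integrable setT (fun z => (F z.1 * G z.2)%:E).
Proof.
move=> iF iG.
have [/measurable_EFinP mF lF] := elimT (integrableP _ _ _) iF.
have [/measurable_EFinP mG lG] := elimT (integrableP _ _ _) iG.
apply/integrable21ltyP.
  by apply/measurable_EFinP; apply: measurable_funM; exact: measurableT_comp.
rewrite (eq_integral (fun y => (\int[m1]_x `|(F x)%:E|) * `|(G y)%:E|)%E).
  rewrite ge0_integralZl ?integral_ge0//.
    by rewrite lte_mul_pinfty ?integral_ge0// ge0_fin_numE ?integral_ge0.
  exact/measurableT_comp/measurable_EFinP.
move=> y _; under eq_integral do rewrite EFinM abseM.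
rewrite /= ge0_integralZr//.
exact/measurable_EFinP/measurableT_comp.
Qed.

Lemma Cintegrable_prod (f : T1 -> R[i]) (g : T2 -> R[i]) (D1 : set T1)
    (D2 : set T2) : measurable D1 -> measurable D2 ->
  Cintegrable m1 D1 f -> Cintegrable m2 D2 g ->
  Cintegrable (m1 \x m2)%E (D1 `*` D2) (fun z => f z.1 * g z.2) /\
  Cintegral (m1 \x m2)%E (D1 `*` D2) (fun z => f z.1 * g z.2) =
  Cintegral m1 D1 f * Cintegral m2 D2 g.
Proof.
move=> mD1 mD2 /(Cintegrable_mkcond _ _ mD1) fi /(Cintegrable_mkcond _ _ mD2) gi.
have mD : measurable (D1 `*` D2) by exact: measurableX.
have E z : (\1_(D1 `*` D2) z)%:C * (f z.1 * g z.2) =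
    ((\1_D1 z.1)%:C * f z.1) * ((\1_D2 z.2)%:C * g z.2) :> R[i].
  by rewrite indic_setX rmorphM; ring.
have I : Cintegrable (m1 \x m2)%E setT (fun z =>
    (\1_(D1 `*` D2) z)%:C * (f z.1 * g z.2)).
  apply: (Cintegrable_le _ _ (integrable_prod (integrable_normc _ fi)
    (integrable_normc _ gi))) => // [|z _]; last by rewrite E normcM.
  under eq_fun do rewrite E.
  apply: CmeasurableM.
    exact: (Cmeasurable_comp (Cintegrable_measurable fi)).
  exact: (Cmeasurable_comp (Cintegrable_measurable gi)).
split; first exact/(Cintegrable_mkcond _ _ mD).
rewrite Cintegral_mkcond Cfubini// [in RHS]Cintegral_mkcond.
rewrite [X in _ = _ * X]Cintegral_mkcond -CintegralZ//.
apply: eq_Cintegral => y _; rewrite mulrC -CintegralZ//.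
by apply: eq_Cintegral => x _; rewrite E mulrC.
Qed.

End complex_fubini.

(** * The Gaussian integral along a line in the complex plane *)

Section one_dimensional_gaussian.
Context (R : realType).
Local Notation mu :=
  (lebesgue_measure : {sigma_finite_measure set (measurableTypeR R) -> \bar R}).

(** Integrability and total mass of real Gaussians are read off from the normal
    law of variance 1 / (2 a). *)
Lemma gauss_normal_pdf (a x : R) : 0 < a ->
  normal_pdf 0 (Num.sqrt (2 * a))^-1 x = Num.sqrt (a / pi) * expR (- (a * x ^+ 2)).
Proof.
move=> a0.
have a20 : 0 < 2 * a by rewrite mulr_gt0.
rewrite normal_pdfE ?invr_neq0 ?gt_eqF ?sqrtr_gt0// /normal_peak /normal_fun.
rewrite exprVn sqr_sqrtr ?ltW// subr0.
move: (pi_gt0 R); move: (@pi R) => p p0.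
have -> : (2 * a)^-1 * p *+ 2 = (a / p)^-1.
  by rewrite -mulr_natr; field; rewrite !gt_eqF.
rewrite sqrtrV ?divr_ge0 ?ltW// invrK; congr (_ * expR _).
by rewrite -mulr_natr; field; rewrite !gt_eqF.
Qed.

Lemma integrable_gauss (a : R) : 0 < a ->
  mu.-integrable setT (fun x => (expR (- (a * x ^+ 2)))%:E).
Proof.
move=> a0.
have := integrable_normal_pdf 0 (Num.sqrt (2 * a))^-1.
move=> /(integrable_scale (Num.sqrt (a / pi))^-1 measurableT).
apply: eq_integrable => // x _ /=; rewrite gauss_normal_pdf// mulKf//.
by rewrite gt_eqF// sqrtr_gt0 divr_gt0// pi_gt0.
Qed.

Lemma Rintegral_gauss_pi : (\int[mu]_x expR (- (pi * x ^+ 2)) = 1 :> R)%R.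
Proof.
rewrite /Rintegral -[RHS]/(fine 1%E).
rewrite -(integral_normal_pdf 0 (Num.sqrt (2 * pi))^-1); congr fine.
apply: eq_integral => x _; rewrite gauss_normal_pdf ?pi_gt0// divff ?sqrtr1 ?mul1r//.
by rewrite gt_eqF// pi_gt0.
Qed.

Lemma is_derive_continuous (f : R -> R) (d : R -> R) :
  (forall x : R, is_derive x 1 f (d x)) -> continuous f.
Proof.
move=> fd x; apply: differentiable_continuous; apply/derivable1_diffP.
exact: (@ex_derive _ _ _ _ _ _ _ (fd x)).
Qed.

Lemma Rintegral_FTC (F f : R -> R) (a b : R) : a < b -> continuous f ->
  (forall x : R, is_derive x 1 F (f x)) ->
  (\int[mu]_(x in `[a, b]) f x = F b - F a)%R.
Proof.
move=> ab cf Ff.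
have cF := is_derive_continuous Ff.
rewrite /Rintegral (@continuous_FTC2 _ f F)//.
- exact: continuous_subspaceT.
- split.
  + by move=> x _; exact: (@ex_derive _ _ _ _ _ _ _ (Ff x)).
  + exact: cvg_at_right_filter (cF a).
  + exact: cvg_at_left_filter (cF b).
- by move=> x _; rewrite derive1E (@derive_val _ _ _ _ _ _ _ (Ff x)).
Qed.

Lemma Cintegral_FTC (F f : R -> R[i]) (a b : R) : a < b ->
  (forall x, exists d, Cderiv f x d) -> (forall x, Cderiv F x (f x)) ->
  Cintegral mu `[a, b] f = F b - F a.
Proof.
move=> ab /choice[f' fd] Ff.
have cf1 : continuous (fun x => complex.Re (f x)).
  apply: (@is_derive_continuous (fun x => complex.Re (f x))
    (fun x => complex.Re (f' x))).
  by move=> x; have [] := fd x.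
have cf2 : continuous (fun x => complex.Im (f x)).
  apply: (@is_derive_continuous (fun x => complex.Im (f x))
    (fun x => complex.Im (f' x))).
  by move=> x; have [] := fd x.
apply: complex_ext; rewrite /= ?ReD ?ReN ?ImD ?ImN.
  apply: (@Rintegral_FTC (fun x => complex.Re (F x)) _ _ _ ab cf1).
  by move=> x; have [] := Ff x.
apply: (@Rintegral_FTC (fun x => complex.Im (F x)) _ _ _ ab cf2).
by move=> x; have [] := Ff x.
Qed.

(** Both sides are the integral of [h] over the rectangle, in the two orders of
    integration.  If phi (s, t) is a homotopy and u is holomorphic, then
    f = u (phi) dphi/dt and g = u (phi) dphi/ds have such a common derivative
    [h], and the equality is the theorem of Cauchy for phi. *)
Lemma rectangle_homotopy (f g h : R -> R -> R[i]) (a b c d K : R) :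
  a < b -> c < d ->
  (forall s t, Cderiv (f ^~ t) s (h s t)) ->
  (forall s t, Cderiv (g s) t (h s t)) ->
  (forall s t, exists e, Cderiv (h ^~ t) s e) ->
  (forall s t, exists e, Cderiv (h s) t e) ->
  Cmeasurable setT (fun z : measurableTypeR R * measurableTypeR R => h z.1 z.2) ->
  (forall s t, `[a, b]%classic s -> `[c, d]%classic t -> normc (h s t) <= K) ->
  Cintegral mu `[c, d] (fun t => f b t - f a t) =
  Cintegral mu `[a, b] (fun s => g s d - g s c).
Proof.
move=> ab cd fh gh hs ht mh hK.
pose D : set (measurableTypeR R * measurableTypeR R) := `[a, b] `*` `[c, d].
have mD : measurable D by apply: measurableX; exact: measurable_itv.
have muD : ((mu \x mu) D < +oo)%E.
  rewrite product_measure1E//; try exact: measurable_itv.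
  by rewrite /= !lebesgue_measure_itv/= !lte_fin ab cd -!EFinB -EFinM ltry.
have hi : Cintegrable (mu \x mu)%E setT (fun z => (\1_D z)%:C * h z.1 z.2).
  apply/(Cintegrable_mkcond _ _ mD).
  apply: (@Cintegrable_le _ _ _ _ _ _ (fun=> K)) => //.
  - by case: mh => m1 m2; split; exact: measurable_funTS.
  - apply: measurable_bounded_integrable => //.
    by exists `|K|; split => // x Kx y _ /=; rewrite ltW.
  - by case=> s t [/= ? ?]; exact: hK.
rewrite [LHS]Cintegral_mkcond [RHS]Cintegral_mkcond.
transitivity (Cintegral mu setT (fun t => Cintegral mu setT
    (fun s => (\1_D (s, t))%:C * h s t))).
  apply: eq_Cintegral => t _; rewrite -(Cintegral_FTC ab (hs^~ t) (fh^~ t)).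
  rewrite Cintegral_mkcond -Cintegral_indicZ; apply: eq_Cintegral => s _.
  by rewrite indic_setX rmorphM; ring.
rewrite -(Cfubini_swap hi); apply: eq_Cintegral => s _ /=.
rewrite -(Cintegral_FTC cd (ht s) (gh s)) [X in _ = _ * X]Cintegral_mkcond.
rewrite -Cintegral_indicZ.
by apply: eq_Cintegral => t _; rewrite indic_setX rmorphM; ring.
Qed.

End one_dimensional_gaussian.

Section contour_rotation.
Context (R : realType).
Local Notation mu :=
  (lebesgue_measure : {sigma_finite_measure set (measurableTypeR R) -> \bar R}).

Definition Cderivable (f : R -> R[i]) x := exists d, Cderiv f x d.

Lemma Cderivable_cst c x : Cderivable (fun=> c) x.
Proof. by exists 0; exact: Cderiv_cst. Qed.

Lemma Cderivable_real x : Cderivable (fun t => t%:C) x.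
Proof. by exists 1; exact: Cderiv_real. Qed.

Lemma CderivableD f g x :
  Cderivable f x -> Cderivable g x -> Cderivable (fun t => f t + g t) x.
Proof. by move=> [a ?] [b ?]; exists (a + b); exact: CderivD. Qed.

Lemma CderivableM f g x :
  Cderivable f x -> Cderivable g x -> Cderivable (fun t => f t * g t) x.
Proof. by move=> [a ?] [b ?]; exists (a * g x + f x * b); exact: CderivM. Qed.

Lemma Cderivable_expC f x : Cderivable f x -> Cderivable (fun t => expC (f t)) x.
Proof. by move=> [a ?]; exists (a * expC (f x)); exact: Cderiv_expC. Qed.

Lemma Cderiv_affine (a b : R[i]) x : Cderiv (fun t => a + t%:C * b) x b.
Proof.
apply: Cderiv_eq (CderivD (Cderiv_cst a x)
  (CderivM (Cderiv_real x) (Cderiv_cst b x))) _.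
by rewrite mul1r mulr0 addr0 add0r.
Qed.

Lemma Cderiv_gauss (p : R -> R[i]) x d : Cderiv p x d ->
  Cderiv (fun t => expC (- pi%:C * (p t * p t))) x
    (- (2 * pi%:C) * (p x * d) * expC (- pi%:C * (p x * p x))).
Proof.
move=> pd.
apply: Cderiv_eq (Cderiv_expC (CderivM (Cderiv_cst (- pi%:C) x)
  (CderivM pd pd))) _.
by rewrite mul0r add0r; congr (_ * _); ring.
Qed.

(** In the cone |b| + k <= a one has a^2 - b^2 >= k^2, and half of k^2 t^2 absorbs
    the linear term. *)
Lemma quadratic_lower_bound (k a b u v P Q t : R) : 0 < k -> `|b| + k <= a ->
  `|a * u - b * v| <= P -> v ^+ 2 <= Q ->
  k ^+ 2 / 2 * t ^+ 2 - (2 * P ^+ 2 / k ^+ 2 + Q) <=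
  (a * t + u) ^+ 2 - (b * t + v) ^+ 2.
Proof.
move=> k0 abk P0 Q0.
have ab : k ^+ 2 <= a ^+ 2 - b ^+ 2.
  rewrite -(real_normK (num_real b)) subr_sqr.
  have b0 := normr_ge0 b.
  by rewrite expr2 ler_pM ?(ltW k0)//; lra.
have t2 : k ^+ 2 * t ^+ 2 <= (a ^+ 2 - b ^+ 2) * t ^+ 2.
  by rewrite ler_wpM2r ?sqr_ge0.
have Pt : - (2 * P * `|t|) <= 2 * (a * u - b * v) * t.
  rewrite -mulrA -[leRHS]mulrA -mulrN ler_pM2l// lerNl -mulNr.
  rewrite (le_trans (ler_norm _))// normrM normrN ler_wpM2r//.
have amgm : 2 * P * `|t| <= k ^+ 2 / 2 * t ^+ 2 + 2 * P ^+ 2 / k ^+ 2.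
  rewrite -subr_ge0 -(real_normK (num_real t)).
  have -> : k ^+ 2 / 2 * `|t| ^+ 2 + 2 * P ^+ 2 / k ^+ 2 - 2 * P * `|t| =
      2^-1 * (k * `|t| - 2 * P / k) ^+ 2.
    by field; rewrite gt_eqF.
  by rewrite mulr_ge0 ?sqr_ge0 ?invr_ge0.
have u0 := sqr_ge0 u.
have -> : (a * t + u) ^+ 2 - (b * t + v) ^+ 2 =
   (a ^+ 2 - b ^+ 2) * t ^+ 2 + 2 * (a * u - b * v) * t + (u ^+ 2 - v ^+ 2).
  by ring.
by lra.
Qed.

Variables (c w : R[i]).
Hypothesis hc : `|complex.Im c| < complex.Re c.

(** [phi s] is the straight-line homotopy from the real line, at [s = 0], to the
    contour [t |-> c * t + w], at [s = 1]; its velocities in [t] and [s] are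
    [path s] and [dphi t], and [E] is exp (- pi z^2) along it. *)
Let path (s : R) : R[i] := 1 + s%:C * (c - 1).
Let phi (s t : R) : R[i] := path s * t%:C + s%:C * w.
Let dphi (t : R) : R[i] := (c - 1) * t%:C + w.
Let E (s t : R) : R[i] := expC (- pi%:C * (phi s t * phi s t)).

Let phi_s s t : Cderiv (phi ^~ t) s (dphi t).
Proof.
have -> : phi ^~ t = fun s => t%:C + s%:C * dphi t.
  by apply/funext => x; rewrite /phi /dphi /path; ring.
exact: Cderiv_affine.
Qed.

Let phi_t s t : Cderiv (phi s) t (path s).
Proof.
have -> : phi s = fun t => s%:C * w + t%:C * path s.
  by apply/funext => x; rewrite /phi; ring.
exact: Cderiv_affine.
Qed.

(** The sector |Im z| < Re z is convex and contains 1 and [c]: along [path],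
    Re z - |Im z| has a positive lower bound, which makes the Gaussian decay
    uniform in [s]. *)
Let E_bound : exists C e, [/\ 0 < e, 0 <= C & forall s t, 0 <= s <= 1 ->
  normc (E s t) <= C * expR (- (e * t ^+ 2))].
Proof.
pose al := complex.Re c; pose be := complex.Im c.
pose w1 := complex.Re w; pose w2 := complex.Im w.
have be0 := normr_ge0 be.
have abe : `|be| < al by [].
pose k := Num.min 1 (al - `|be|).
have k0 : 0 < k by rewrite lt_min ltr01 subr_gt0.
have k1 : k <= 1 by rewrite ge_min lexx.
have k2 : k <= al - `|be| by rewrite ge_min lexx orbT.
pose P := (1 + al + `|be|) * (`|w1| + `|w2|).
pose L := 2 * P ^+ 2 / k ^+ 2 + w2 ^+ 2.
exists (expR (pi * L)), (pi * (k ^+ 2 / 2)); split.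
- by rewrite mulr_gt0 ?pi_gt0// divr_gt0// exprn_gt0.
- exact: expR_ge0.
move=> s t /andP[s0 s1].
rewrite /E normc_expC -expRD ler_expR.
have -> : complex.Re (- pi%:C * (phi s t * phi s t)) =
  - (pi * (((1 + s * (al - 1)) * t + s * w1) ^+ 2 - (s * be * t + s * w2) ^+ 2)).
  rewrite /phi /path !(ReM, ImM, ReN, ImN, ReD, ImD) /= -/al -/be -/w1 -/w2.
  by ring.
set X := (_ - _ : R); suff key : k ^+ 2 / 2 * t ^+ 2 - L <= X.
  move: (@pi R) (pi_ge0 R) => p p0.
  by have := ler_wpM2l p0 key; lra.
have ss : s ^+ 2 <= 1 by rewrite expr_le1.
apply: quadratic_lower_bound => //.
- rewrite normrM ger0_norm//.
  by nra.
- have sw z : `|s * z| <= `|z| by rewrite normrM ger0_norm// ler_piMl.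
  rewrite (le_trans (ler_normB _ _))// /P [leRHS]mulrDr.
  rewrite lerD// normrM ler_pM// ?sw//; first by rewrite ger0_norm; nra.
  by have := sw be; lra.
- by rewrite exprMn ler_piMl// sqr_ge0.
Qed.

(** The components in [t] and in [s] of the pullback by [phi] of the closed form
    exp (- pi z^2) dz, and the common value [h] of their cross derivatives. *)
Let f s t := path s * E s t.
Let g s t := dphi t * E s t.
Let h s t := (c - 1 + path s * (- (2 * pi%:C) * (phi s t * dphi t))) * E s t.

Let f_s s t : Cderiv (f ^~ t) s (h s t).
Proof.
have := CderivM (Cderiv_affine 1 (c - 1) s) (Cderiv_gauss (phi_s s t)).
by move/Cderiv_eq; apply; rewrite /h /E /path; ring.
Qed.

Let g_t s t : Cderiv (g s) t (h s t).
Proof.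
have := CderivM (Cderiv_affine w (c - 1) t) (Cderiv_gauss (phi_t s t)).
have -> : (fun t0 => (w + t0%:C * (c - 1)) * expC (- pi%:C *
    (phi s t0 * phi s t0))) = g s.
  by apply/funext => x; rewrite /g /E /dphi addrC (mulrC x%:C).
by move/Cderiv_eq; apply; rewrite /h /E /dphi; ring.
Qed.

Let h_s s t : Cderivable (h ^~ t) s.
Proof.
rewrite /h /E /phi /dphi /path.
by repeat first [exact: Cderivable_cst | exact: Cderivable_real |
  apply: Cderivable_expC | apply: CderivableM | apply: CderivableD].
Qed.

Let h_t s t : Cderivable (h s) t.
Proof.
rewrite /h /E /phi /dphi /path.
by repeat first [exact: Cderivable_cst | exact: Cderivable_real |
  apply: Cderivable_expC | apply: CderivableM | apply: CderivableD].
Qed.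

Let mphi d (T : measurableType d) (a b : T -> R) :
  measurable_fun setT a -> measurable_fun setT b ->
  Cmeasurable setT (fun x => phi (a x) (b x)).
Proof.
move=> /Cmeasurable_real ma /Cmeasurable_real mb.
rewrite /phi /path; apply: CmeasurableD.
  apply: CmeasurableM => //; apply: CmeasurableD; first exact: Cmeasurable_cst.
  by apply: CmeasurableM => //; exact: Cmeasurable_cst.
by apply: CmeasurableM => //; exact: Cmeasurable_cst.
Qed.

Let mE d (T : measurableType d) (a b : T -> R) :
  measurable_fun setT a -> measurable_fun setT b ->
  Cmeasurable setT (fun x => E (a x) (b x)).
Proof.
move=> ma mb; apply: Cmeasurable_expC.
apply: CmeasurableM; first exact: Cmeasurable_cst.
by apply: CmeasurableM; exact: mphi.
Qed.

Let mh : Cmeasurable setT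
  (fun z : measurableTypeR R * measurableTypeR R => h z.1 z.2).
Proof.
have m1 : measurable_fun setT
  (fun z : measurableTypeR R * measurableTypeR R => z.1 : R).
  exact: measurable_fst.
have m2 : measurable_fun setT
  (fun z : measurableTypeR R * measurableTypeR R => z.2 : R).
  exact: measurable_snd.
have c1 := Cmeasurable_real m1; have c2 := Cmeasurable_real m2.
rewrite /h /path /dphi; apply: CmeasurableM; last exact: mE.
apply: CmeasurableD; first exact: Cmeasurable_cst.
apply: CmeasurableM.
  apply: CmeasurableD; first exact: Cmeasurable_cst.
  by apply: CmeasurableM => //; exact: Cmeasurable_cst.
apply: CmeasurableM; first exact: Cmeasurable_cst.
apply: CmeasurableM; first exact: mphi.
apply: CmeasurableD; last exact: Cmeasurable_cst.
by apply: CmeasurableM => //; exact: Cmeasurable_cst.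
Qed.

Let iE s : 0 <= s <= 1 -> Cintegrable mu setT (E s).
Proof.
move=> s01; have [C [e [e0 C0 EC]]] := E_bound.
have mEs : Cmeasurable setT (E s : measurableTypeR R -> R[i]).
  by apply: (@mE _ (measurableTypeR R) (fun=> s) (fun t => t)).
apply: (Cintegrable_le _ mEs (integrable_scale C _ (integrable_gauss e0))) => //.
by move=> t _; exact: EC.
Qed.

(** The contribution of the two sides [t = n + 1] and [t = - (n + 1)] of the
    rectangle. *)
Let boundary (n : nat) : R[i] :=
  Cintegral mu `[0, 1] (fun s => g s n.+1%:R - g s (- n.+1%:R)).

Let boundary_small : exists B, forall n, normc (boundary n) <= B / n.+1%:R.
Proof.
have [C [e [e0 C0 EC]]] := E_bound.
pose A := normc (c - 1) + normc w.
have A0 : 0 <= A by rewrite addr_ge0 ?normc_ge0.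
(* On these sides the velocity is at most A T, and the Gaussian C / (e T^2). *)
exists (2 * (2 * (A * (C / e)))) => n; set T : R := n.+1%:R.
have T0 : 0 < T by rewrite ltr0n.
have T1 : 1 <= T by rewrite ler1n.
have gb s t : 0 <= s <= 1 -> `|t| = T -> normc (g s t) <= A * (C / e) / T.
  move=> s01 tT; rewrite normcM.
  have dt : normc (dphi t) <= A * T.
    rewrite (le_trans (le_normcD _ _))// normcM normcR tT mulrDl lerD2l.
    by rewrite ler_peMr ?normc_ge0.
  have Et : normc (E s t) <= C * (e * T ^+ 2)^-1.
    rewrite (le_trans (EC _ _ s01))// ler_wpM2l// expRN lef_pV2 ?posrE.
    - by rewrite -(real_normK (num_real t)) tT (le_trans _ (expR_ge1Dx _))// lerDr.
    - exact: expR_gt0.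
    - by rewrite mulr_gt0 ?exprn_gt0.
  rewrite (le_trans (ler_pM _ _ dt Et)) ?normc_ge0//.
  by rewrite le_eqVlt; apply/orP; left; apply/eqP; field; rewrite !gt_eqF.
have mg t : Cmeasurable setT (fun s : measurableTypeR R => g s t).
  apply: CmeasurableM; first exact: Cmeasurable_cst.
  by apply: (@mE _ (measurableTypeR R) (fun s => s) (fun=> t)).
have [||||_ bb] := @normc_Cintegral_le _ _ R mu `[0, 1]
    (fun s => g s T - g s (- T)) (2 * (A * (C / e) / T)).
- exact: measurable_itv.
- by rewrite /= lebesgue_measure_itv/= lte_fin ltr01 -EFinB ltry.
- have [m1 m2] := CmeasurableD (mg T) (CmeasurableN (mg (- T))).
  by split; apply: measurable_funTS.
- move=> s; rewrite /= in_itv/= => s01.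
  rewrite (le_trans (le_normcD _ _))// normcN mulr_natl mulr2n lerD// gb//.
    by rewrite ger0_norm// ltW.
  by rewrite normrN ger0_norm// ltW.
rewrite (le_trans bb)//= lebesgue_measure_itv/= lte_fin ltr01 /= subr0 mulr1.
by rewrite !mulrA.
Qed.

Let truncation (u : R -> R[i]) : Cintegrable mu setT u ->
  Ccvg (fun n => Cintegral mu `[- n.+1%:R, n.+1%:R] u) (Cintegral mu setT u).
Proof.
move=> iu; rewrite (_ : (fun n => _) = fun n => Cintegral mu setT
    (fun x => (\1_(`[- n.+1%:R, n.+1%:R] : set R) x)%:C * u x)); last first.
  by apply/funext => n; rewrite Cintegral_mkcond.
have mu_ := Cintegrable_measurable iu.
have [] // := Cdominated_convergence (mu := mu) measurableT _
  (integrable_normc measurableT iu)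
  (f_ := fun n x => (\1_(`[- n.+1%:R, n.+1%:R] : set R) x)%:C * u x) (f := u).
- move=> n; apply: CmeasurableM => //; apply: Cmeasurable_real.
  exact: measurable_indic.
- move=> n x _; rewrite normcM normcR ler_piMl ?normc_ge0// indicE.
  by case: (_ \in _); rewrite ?normr1 ?normr0.
- move=> x _; rewrite -[X in Ccvg _ X]mul1r; apply: CcvgM (Ccvg_cst _).
  have [N xN] : exists N, forall n, (N <= n)%N -> `|x| <= n.+1%:R.
    exists (Num.truncn `|x|) => n Nn.
    rewrite (le_trans (ltW (truncnS_gt _)))// ler_nat ltnS//.
  split => /=; last exact: cvg_cst.
  apply: cvg_near_cst; exists N => // n /= /xN xn.
  by rewrite indicE mem_set//= in_itv/= -ler_norml.
Qed.

(** The integrals over the segments of half-length n + 1 of the two contours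
    differ by [boundary n], which tends to 0. *)
Lemma complex_gaussian_integral :
  Cintegrable mu setT (fun t => expC (- pi%:C * (c * t%:C + w) ^+ 2)) /\
  Cintegral mu setT (fun t => expC (- pi%:C * (c * t%:C + w) ^+ 2)) = c^-1.
Proof.
have p1 : path 1 = c by rewrite /path mul1r addrC subrK.
have p0 : path 0 = 1 by rewrite /path mul0r addr0.
have E1 : (fun t => expC (- pi%:C * (c * t%:C + w) ^+ 2)) = E 1.
  by apply/funext => t; rewrite /E /phi p1 expr2 mul1r.
have E0 : E 0 = fun t => (expR (- (pi * t ^+ 2)))%:C.
  apply/funext => t; rewrite /E /phi p0 mul0r addr0 mul1r.
  by rewrite -expr2 -expC_real mulNr rmorphN rmorphM rmorphXn.
have i1 : Cintegrable mu setT (E 1) by apply: iE; rewrite ler01 lexx.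
have i0 : Cintegrable mu setT (E 0) by apply: iE; rewrite ler01 lexx.
have c0 : c != 0.
  apply/eqP => c0; move: hc; rewrite c0 /= normr0 ltxx//.
rewrite E1; split => //.
have J0 : Cintegral mu setT (E 0) = 1.
  rewrite E0; apply: complex_ext => /=; first exact: Rintegral_gauss_pi.
  by rewrite /Rintegral integral0.
apply: (mulfI c0); rewrite mulfV// -J0.
apply/eqP; rewrite -subr_eq0; apply/eqP.
have f1 : f 1 = fun t => c * E 1 t.
  by apply/funext => t; rewrite /f p1.
have f0 : f 0 = E 0.
  by apply/funext => t; rewrite /f p0 mul1r.
have if1 : Cintegrable mu setT (f 1) by rewrite f1; exact: CintegrableM.
have if0 : Cintegrable mu setT (f 0) by rewrite f0.
rewrite -CintegralZ// -f1 -f0.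
have [B hB] := boundary_small.
apply: (@Ccvg_unique _ boundary); last first.
  apply: (@Ccvg_norm _ _ _ (fun n => B / n.+1%:R)) => [|n]; last by rewrite subr0.
  rewrite -[X in _ --> X](mulr0 B); apply: cvgM; first exact: cvg_cst.
  exact: cvg_harmonic.
have mT n : measurable (`[- n.+1%:R, n.+1%:R] : set (measurableTypeR R)).
  exact: measurable_itv.
have sub n u : Cintegrable mu setT u ->
    Cintegrable mu `[- n.+1%:R, n.+1%:R] u.
  by move=> [u1 u2]; split; apply: (integrableS measurableT (mT n) (@subsetT _ _)).
have bE n : boundary n = Cintegral mu `[- n.+1%:R, n.+1%:R] (f 1) -
    Cintegral mu `[- n.+1%:R, n.+1%:R] (f 0).
  have T0 : - n.+1%:R < n.+1%:R :> R by rewrite (@lt_trans _ _ 0)// oppr_lt0.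
  rewrite -[X in _ = _ + X]mulN1r -CintegralZ//; last exact: sub.
  rewrite -CintegralD//; [|exact: sub|by apply: CintegrableM => //; exact: sub].
  have [C [e [e0 C0 EC]]] := E_bound.
  have [K hK] : exists K, forall s t, `[0, 1]%classic s ->
      `[- n.+1%:R, n.+1%:R]%classic t -> normc (h s t) <= K.
    pose q := normc (c - 1); pose v := normc w; set T : R := n.+1%:R.
    exists ((q + (1 + q) * (2 * pi * (((1 + q) * T + v) * (q * T + v)))) * C).
    move=> s t; rewrite /= !in_itv/= -ler_norml => s01 tT.
    have /andP[s0 s1] := s01.
    have q0 : 0 <= q := normc_ge0 _; have v0 : 0 <= v := normc_ge0 _.
    have ps : normc (path s) <= 1 + q.
      rewrite (le_trans (le_normcD _ _))// normc1 lerD2l normcM normcR.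
      by rewrite ger0_norm// ler_piMl.
    have ph : normc (phi s t) <= (1 + q) * T + v.
      rewrite (le_trans (le_normcD _ _))// !normcM !normcR lerD//.
        by rewrite ler_pM ?normc_ge0.
      by rewrite ger0_norm// ler_piMl.
    have dp : normc (dphi t) <= q * T + v.
      by rewrite (le_trans (le_normcD _ _))// normcM normcR lerD2r ler_wpM2l.
    have Es : normc (E s t) <= C.
      rewrite (le_trans (EC _ _ s01))// ler_piMr// -expR0 ler_expR oppr_le0.
      by rewrite mulr_ge0 ?sqr_ge0 ?ltW.
    rewrite normcM ler_pM ?normc_ge0// (le_trans (le_normcD _ _))// lerD2l.
    rewrite normcM ler_pM ?normc_ge0// normcM ler_pM ?normc_ge0//.
      rewrite normcN normcM !normcR (ger0_norm (pi_ge0 R)) -[2]/(2%:R).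
      by rewrite -(rmorph_nat (real_complex R)) normcR ger0_norm.
    by rewrite normcM ler_pM ?normc_ge0.
  have := rectangle_homotopy ltr01 T0 f_s g_t h_s h_t mh hK.
  rewrite -/(boundary n) => <-.
  by apply: eq_Cintegral => t _; rewrite mulN1r.
by rewrite (funext bE); exact: CcvgB (truncation if1) (truncation if0).
Qed.

End contour_rotation.

(** * Schur complements and positivity *)

Section schur.
Context (F : fieldType) (n : nat) (M : 'M[F]_(1 + n)).
Hypothesis Msym : M^T = M.
Hypothesis M00 : M 0 0 != 0.

Definition schur_complement : 'M[F]_n :=
  drsubmx M - (M 0 0)^-1 *: (dlsubmx M *m (dlsubmx M)^T).
Local Notation S := schur_complement.

Let Mblock : M = block_mx (M 0 0)%:M (dlsubmx M)^T (dlsubmx M) (drsubmx M).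
Proof.
rewrite -{1}(submxK M); congr block_mx.
  by apply/matrixP => i j; rewrite !ord1 !mxE !lshift0.
by rewrite -{1}Msym trmx_dlsub.
Qed.

Lemma schur_complement_sym : S^T = S.
Proof.
rewrite /schur_complement linearB linearZ /= trmx_mul trmxK.
by rewrite trmx_drsub Msym.
Qed.

Lemma det_schur : \det M = M 0 0 * \det S.
Proof.
have E : M = block_mx 1%:M 0 ((M 0 0)^-1 *: dlsubmx M) 1%:M *m
    block_mx (M 0 0)%:M (dlsubmx M)^T 0 S.
  rewrite mulmx_block !mul1mx !mul0mx !addr0 -scalemxAl.
  rewrite mul_mx_scalar scalerA mulVf// scale1r -scalemxAl addrC subrK.
  exact: Mblock.
by rewrite {1}E det_mulmx det_lblock det_ublock !det1 !mul1r det_scalar1.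
Qed.

(** Completing the square in the first coordinate. *)
Lemma dot_schur (t : F) (v : 'cV[F]_n) :
  dot (col_mx t%:M v) (M *m col_mx t%:M v) =
  M 0 0 * (t + (M 0 0)^-1 * dot (dlsubmx M) v) ^+ 2 + dot v (S *m v).
Proof.
set a := M 0 0; set b := dlsubmx M.
have bv : b^T *m v = (dot b v)%:M by rewrite [LHS]mx11_scalar.
have vb : v^T *m b = (dot b v)%:M.
  by rewrite -[LHS]trmxK trmx_mul trmxK bv tr_scalar_mx.
have -> : dot (col_mx t%:M v) (M *m col_mx t%:M v) =
    (t * (a * t) + t * dot b v + (t * dot b v)) + dot v (drsubmx M *m v).
  rewrite {1}/dot {1}Mblock -/a -/b mul_block_col tr_col_mx mul_row_col.
  rewrite bv tr_scalar_mx !mulmxDr !mul_scalar_mx mul_mx_scalar -!scalemxAr vb.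
  by rewrite /dot; set D := v^T *m (_ *m v); rewrite !mxE /= !mulr1n; ring.
have -> : dot v (S *m v) = dot v (drsubmx M *m v) - a^-1 * dot b v ^+ 2.
  rewrite /dot /schur_complement -/a -/b mulmxBl mulmxBr mxE; congr (_ + _).
  rewrite mxE -scalemxAl -scalemxAr -!mulmxA bv mul_mx_scalar -scalemxAr vb.
  by rewrite mxE [X in _ * X]mxE mxE /= mulr1n expr2.
by field.
Qed.

End schur.

Lemma dot_delta (F : pzRingType) n (M : 'M[F]_n) i :
  dot (delta_mx i 0) (M *m delta_mx i 0) = M i i.
Proof. by rewrite /dot -colE trmx_delta -rowE !mxE. Qed.

Lemma col_mx_split (F : pzRingType) n (v : 'cV[F]_(1 + n)) :
  v = col_mx (v 0 0)%:M (dsubmx v).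
Proof.
rewrite -{1}(vsubmxK v); congr col_mx; apply/matrixP => i j.
by rewrite !ord1 !mxE lshift0.
Qed.

Lemma dot_col_mx (F : pzRingType) n (s t : F) (u v : 'cV[F]_n) :
  dot (col_mx s%:M u) (col_mx t%:M v) = s * t + dot u v.
Proof.
by rewrite /dot tr_col_mx mul_row_col tr_scalar_mx mul_scalar_mx !mxE /= mulr1n.
Qed.

Lemma col_mx_neq0 (F : pzRingType) n (t : F) (v : 'cV[F]_n) :
  v != 0 -> col_mx t%:M v != 0.
Proof. by apply: contraNneq => /(congr1 dsubmx); rewrite col_mxKd linear0 => ->. Qed.

Section positive_forms.
Context (R : realType).

Lemma dot_norm_ge0 n (v : 'cV[R]_n) : 0 <= dot v v.
Proof. by rewrite /dot mxE sumr_ge0// => i _; rewrite mxE -expr2 sqr_ge0. Qed.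

Lemma dotE n (u v : 'cV[R]_n) : dot u v = \sum_i u i 0 * v i 0.
Proof. by rewrite /dot mxE; apply: eq_bigr => i _; rewrite mxE. Qed.

(** Lagrange's identity. *)
Lemma dot_Cauchy_Schwarz n (u v : 'cV[R]_n) :
  dot u v ^+ 2 <= dot u u * dot v v.
Proof.
have : 0 <= \sum_i \sum_j (u i 0 * v j 0 - u j 0 * v i 0) ^+ 2.
  by do 2!apply: sumr_ge0 => ? _; exact: sqr_ge0.
have -> : \sum_i \sum_j (u i 0 * v j 0 - u j 0 * v i 0) ^+ 2 =
    2 * (dot u u * dot v v - dot u v ^+ 2).
  have key i j : (u i 0 * v j 0 - u j 0 * v i 0) ^+ 2 =
      u i 0 * u i 0 * (v j 0 * v j 0) + v i 0 * v i 0 * (u j 0 * u j 0)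
      - 2 * (u i 0 * v i 0 * (u j 0 * v j 0)) by ring.
  rewrite (eq_bigr _ (fun i _ => eq_bigr _ (fun j _ => key i j))).
  transitivity (dot u u * dot v v + dot v v * dot u u - 2 * dot u v ^+ 2).
    rewrite expr2 !dotE !big_distrlr /= mulr_sumr -big_split -sumrB /=.
    apply: eq_bigr => i _; rewrite mulr_sumr -big_split -sumrB /=.
    by apply: eq_bigr => j _.
  by ring.
by rewrite pmulr_rge0// subr_ge0.
Qed.

(** Induction on the size: completing the square bounds the form below by
    Y00 (t + u)^2 + c |v|^2, and u^2 is controlled by |v|^2. *)
Lemma posdef_coercive n (Y : 'M[R]_n) : Y^T = Y ->
  (forall v, v != 0 -> 0 < dot v (Y *m v)) ->
  exists2 c, 0 < c & forall v, c * dot v v <= dot v (Y *m v).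
Proof.
elim: n Y => [|n IH] Y Ysym Ypos.
  by exists 1 => // v; rewrite [v]flatmx0 mulmx0 /dot mulmx0 mxE mulr0.
have Y00 : 0 < Y 0 0.
  rewrite -(dot_delta Y); apply: Ypos; apply/eqP => /matrixP/(_ 0 0).
  by rewrite !mxE eqxx => /eqP; rewrite oner_eq0.
have Y00' : Y 0 0 != 0 by rewrite gt_eqF.
pose b := dlsubmx (Y : 'M[R]_(1 + n)).
have QE t v := @dot_schur R n Y Ysym Y00' t v.
have Spos (v : 'cV_n) : v != 0 -> 0 < dot v (@schur_complement R n Y *m v).
  move=> v0; have := Ypos _ (col_mx_neq0 (- ((Y 0 0)^-1 * dot b v)) v0).
  by rewrite QE addNr expr0n /= mulr0 add0r.
have [c c0 Sc] := IH _ (schur_complement_sym Ysym) Spos.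
pose D := (Y 0 0)^-1 ^+ 2 * dot b b.
have D0 : 0 <= D by rewrite mulr_ge0 ?sqr_ge0// dot_norm_ge0.
(* Small enough for t^2 <= 2 (t + u)^2 + 2 u^2 to fit under the two terms. *)
pose e := Num.min (Y 0 0 / 2) (c / (2 * D + 1)).
have D1 : 0 < 2 * D + 1 by rewrite ltr_wpDl// mulr_ge0.
have e0 : 0 < e by rewrite lt_min !divr_gt0.
exists e => // v; rewrite (col_mx_split (v : 'cV_(1 + n))).
move: (v 0 0) (dsubmx _) => t {}v.
rewrite QE dot_col_mx.
set u := (Y 0 0)^-1 * dot _ _; have uD : u ^+ 2 <= D * dot v v.
  by rewrite /u /D exprMn -mulrA ler_wpM2l ?sqr_ge0// dot_Cauchy_Schwarz.
have e1 : e <= Y 0 0 / 2 by rewrite ge_min lexx.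
have e2 : e * (2 * D + 1) <= c by rewrite -ler_pdivlMr// ge_min lexx orbT.
have v0 := dot_norm_ge0 v.
apply: le_trans (lerD (ler_wpM2r (sqr_ge0 (t + u)) (_ : 2 * e <= _)) (Sc v)).
  have := ler_wpM2r v0 e2.
  have : t * t <= 2 * (t + u) ^+ 2 + 2 * u ^+ 2.
    by rewrite -subr_ge0 (_ : _ - _ = (t + 2 * u) ^+ 2) ?sqr_ge0//; ring.
  move=> /(ler_wpM2l (ltW e0)); have := ler_wpM2l (ltW e0) uD; lra.
by rewrite mulrC -ler_pdivlMr.
Qed.

Implicit Types (g : nat).

(** Symmetric complex matrices with positive definite real part: the region in
    which the Gaussian integral converges absolutely. *)
Definition re_posdef g (M : 'M[R[i]]_g) :=
  M^T = M /\ forall v : 'cV[R]_g, v != 0 -> 0 < complex.Re (quad M v).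

Lemma Re_quad g (M : 'M[R[i]]_g) (v : 'cV[R]_g) :
  complex.Re (quad M v) = dot v (map_mx (@complex.Re R) M *m v).
Proof.
rewrite /quad /dot !mxE Re_sum; apply: eq_bigr => i _.
rewrite !mxE ReM /= mul0r subr0 Re_sum; congr (_ * _).
by apply: eq_bigr => j _; rewrite !mxE ReM /= mulr0 subr0.
Qed.

Lemma re_posdef_coercive g (M : 'M[R[i]]_g) : re_posdef M ->
  exists2 c, 0 < c & forall v, c * dot v v <= complex.Re (quad M v).
Proof.
move=> [Ms Mp]; have [||c c0 cM] := @posdef_coercive g (map_mx (@complex.Re R) M).
- by rewrite map_trmx Ms.
- by move=> v /Mp; rewrite Re_quad.
- by exists c => // v; rewrite Re_quad.
Qed.

Lemma quad_schur g (M : 'M[R[i]]_(1 + g)) (t : R) (v : 'cV[R]_g) :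
  M^T = M -> M 0 0 != 0 ->
  quad M (col_mx t%:M v) = M 0 0 *
    (t%:C + (M 0 0)^-1 * dot (dlsubmx M) (map_mx (fun r => r%:C) v)) ^+ 2
    + quad (schur_complement M) v.
Proof.
move=> Ms M0; rewrite /quad map_col_mx.
have -> : map_mx (fun r : R => r%:C) t%:M = (t%:C)%:M :> 'M[R[i]]_1.
  exact: map_scalar_mx.
exact: dot_schur.
Qed.

(** Over real t, the real part of a (t + s)^2 is least at this t, where it is
    - (Im s)^2 |a|^2 / Re a. *)
Lemma Re_mul_sqr_le0 (a s : R[i]) : 0 < complex.Re a ->
  complex.Re (a * ((- complex.Re s + complex.Im a * complex.Im s / complex.Re a)%:C
    + s) ^+ 2) <= 0.
Proof.
case: a s => [a1 a2] [s1 s2] a0.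
rewrite expr2 !(ReM, ImM, ReD, ImD) /=; rewrite /= in a0.
set x := (X in X <= 0); suff -> : x = - ((s2 / a1) ^+ 2 * a1 * (a1 ^+ 2 + a2 ^+ 2)).
  by rewrite oppr_le0 mulr_ge0 ?addr_ge0 ?sqr_ge0// mulr_ge0 ?sqr_ge0 ?(ltW a0).
by rewrite /x; field; rewrite gt_eqF.
Qed.

(** Complete the square at the real first coordinate given by [Re_mul_sqr_le0]:
    the square does not contribute positively, so that the form of the Schur
    complement inherits the positivity. *)
Lemma re_posdef_schur g (M : 'M[R[i]]_(1 + g)) : re_posdef M ->
  0 < complex.Re (M 0 0) /\ re_posdef (schur_complement M).
Proof.
move=> [Ms Mp].
have a0 : 0 < complex.Re (M 0 0).
  have d0 : delta_mx 0 0 != 0 :> 'cV[R]_(1 + g).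
    apply/eqP => /matrixP/(_ 0 0).
    by rewrite !mxE !eqxx => /eqP; rewrite oner_eq0.
  have := Mp _ d0; rewrite /quad.
  have -> : map_mx (fun r : R => r%:C) (delta_mx 0 0) =
      delta_mx 0 0 :> 'cV[R[i]]_(1 + g).
    by apply/matrixP => i j; rewrite !mxE; case: (_ && _).
  by rewrite dot_delta.
have M0 : M 0 0 != 0 by apply: contraTneq a0 => ->; rewrite ltxx.
split => //; split; first exact: schur_complement_sym.
move=> v v0.
pose s := (M 0 0)^-1 * dot (dlsubmx M) (map_mx (fun r => r%:C) v).
have := Mp _ (col_mx_neq0
  (- complex.Re s + complex.Im (M 0 0) * complex.Im s / complex.Re (M 0 0)) v0).
by rewrite quad_schur// -/s ReD => /lt_le_trans; apply; rewrite gerDr Re_mul_sqr_le0.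
Qed.

End positive_forms.

(** * Fubini for Lebesgue measure on tuples *)

Section lebesgue_tuple_fubini.
Context (R : realType).
Local Notation mu :=
  (lebesgue_measure : {sigma_finite_measure set (measurableTypeR R) -> \bar R}).
Local Notation leb := (lebesgue_tuple R).

Lemma integrable_lebesgue_tupleS g (f : g.+1.-tuple R -> \bar R) :
  measurable_fun setT f ->
  (mu \x leb g)%E.-integrable setT (f \o @tcons R g) ->
  (leb g.+1).-integrable setT f.
Proof.
move=> mf fi; have := integrable_pushforward (@measurable_tcons R g) mf.
by move=> /(_ (mu \x leb g)%E setT); rewrite preimage_setT => /(_ fi measurableT).
Qed.

Lemma Rintegral_lebesgue_tupleS g (f : g.+1.-tuple R -> R) :
  measurable_fun setT f ->
  (mu \x leb g)%E.-integrable setT (EFin \o f \o @tcons R g) ->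
  (\int[leb g.+1]_x f x = \int[(mu \x leb g)%E]_z f (tcons z))%R.
Proof.
move=> /measurable_EFinP mf fi; congr fine.
have := integral_pushforward (@measurable_tcons R g) mf.
by move=> /(_ (mu \x leb g)%E setT); rewrite preimage_setT => /(_ fi measurableT).
Qed.

Lemma Cintegral_lebesgue_tupleS g (f : g.+1.-tuple R -> R[i]) :
  Cmeasurable setT f ->
  Cintegrable (mu \x leb g)%E setT (fun z => f (tcons z)) ->
  Cintegral (leb g.+1) setT f =
  Cintegral (mu \x leb g)%E setT (fun z => f (tcons z)).
Proof.
move=> [m1 m2] [i1 i2].
by apply: complex_ext; rewrite /= Rintegral_lebesgue_tupleS.
Qed.

Lemma integrable_lebesgue_tuple0 (f : 0.-tuple R -> R) :
  measurable_fun setT f -> (leb 0).-integrable setT (EFin \o f).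
Proof.
move=> mf; apply/integrableP; split; first exact/measurable_EFinP.
rewrite integral_dirac//; last exact/measurableT_comp/measurable_EFinP.
by rewrite diracE mem_set// mul1e /= ltry.
Qed.

Lemma Cintegral_lebesgue_tuple0 (f : 0.-tuple R -> R[i]) :
  Cmeasurable setT f -> Cintegral (leb 0) setT f = f [tuple].
Proof.
move=> [m1 m2]; apply: complex_ext; rewrite /= /Rintegral integral_dirac//.
- by rewrite diracE mem_set// mul1e.
- exact/measurable_EFinP.
- by rewrite diracE mem_set// mul1e.
- exact/measurable_EFinP.
Qed.

Lemma colv_tcons g (t : R) (e : g.-tuple R) :
  colv (tcons (t, e)) = col_mx t%:M (colv e) :> 'cV_(1 + g).
Proof.
apply/matrixP => i j; rewrite !ord1 !mxE.
rewrite (tnth_nth t); case: splitP => k -> /=.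
  by rewrite ord1 mxE.
by rewrite mxE (tnth_nth t).
Qed.

Lemma measurable_colv g i : measurable_fun setT (fun x : g.-tuple R => colv x i 0).
Proof. by under eq_fun do rewrite mxE; exact: measurable_tnth. Qed.

Lemma quadE g (M : 'M[R[i]]_g) v :
  quad M v = \sum_i (v i 0)%:C * \sum_j M i j * (v j 0)%:C.
Proof.
rewrite /quad /dot mxE; apply: eq_bigr => i _; rewrite !mxE; congr (_ * _).
by apply: eq_bigr => j _; rewrite mxE.
Qed.

Lemma Cmeasurable_quad d (T : measurableType d) g (M : 'M[R[i]]_g)
    (v : T -> 'cV[R]_g) : (forall i, measurable_fun setT (fun x => v x i 0)) ->
  Cmeasurable setT (fun x => quad M (v x)).
Proof.
move=> mv; under eq_fun do rewrite quadE.
apply: Cmeasurable_sum => i; apply: CmeasurableM; first exact: Cmeasurable_real.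
apply: Cmeasurable_sum => j; apply: CmeasurableM; first exact: Cmeasurable_cst.
exact: Cmeasurable_real.
Qed.

Lemma dot_colv g (x : g.-tuple R) : dot (colv x) (colv x) = \sum_i tnth x i ^+ 2.
Proof. by rewrite dotE; apply: eq_bigr => i _; rewrite !mxE expr2. Qed.

Lemma integrable_gauss_tuple g (a : R) : 0 < a ->
  (leb g).-integrable setT
    (fun x => (expR (- (a * dot (colv x) (colv x))))%:E).
Proof.
move=> a0.
have mg n : measurable_fun setT
    (fun x : n.-tuple R => expR (- (a * dot (colv x) (colv x)))).
  apply: measurableT_comp => //; apply: measurableT_comp => //.
  apply: measurable_funM => //; under eq_fun do rewrite dot_colv.
  by apply: measurable_sum => i; apply: measurable_funX; exact: measurable_tnth.
elim: g => [|g IH]; first exact: integrable_lebesgue_tuple0.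
apply: integrable_lebesgue_tupleS; first by apply/measurable_EFinP; exact: mg.
have := integrable_prod (integrable_gauss a0) IH.
congr (_.-integrable _ _); apply/funext => -[t e] /=; rewrite -expRD.
by congr (expR _)%:E; rewrite colv_tcons dot_col_mx -expr2; ring.
Qed.

End lebesgue_tuple_fubini.

(** * Gaussian integrals in several variables *)

Section gaussian_integral.
Context (R : realType).
Local Notation mu :=
  (lebesgue_measure : {sigma_finite_measure set (measurableTypeR R) -> \bar R}).
Local Notation leb := (lebesgue_tuple R).

Definition gauss g (M : 'M[R[i]]_g) (v : 'cV[R]_g) : R[i] :=
  expC (- (pi%:C * quad M v)).

Lemma Cmeasurable_gauss d (T : measurableType d) g (M : 'M[R[i]]_g)
    (v : T -> 'cV[R]_g) : (forall i, measurable_fun setT (fun x => v x i 0)) ->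
  Cmeasurable setT (fun x => gauss M (v x)).
Proof.
move=> mv; apply: Cmeasurable_expC; apply: CmeasurableN.
apply: CmeasurableM; [exact: Cmeasurable_cst|exact: Cmeasurable_quad].
Qed.

Lemma measurable_affine g (r : R) (u : 'cV[R]_g) i :
  measurable_fun setT (fun x : g.-tuple R => (r *: colv x + u) i 0).
Proof.
under eq_fun do rewrite !mxE.
apply: measurable_funD => //; apply: measurable_funM => //.
exact: measurable_tnth.
Qed.

Lemma normc_gauss_le g (M : 'M[R[i]]_g) c v :
  (forall v, c * dot v v <= complex.Re (quad M v)) ->
  normc (gauss M v) <= expR (- (pi * c * dot v v)).
Proof.
move=> cM; rewrite normc_expC ler_expR ReN ReM /= mul0r subr0 lerN2 -mulrA.
by rewrite ler_wpM2l ?pi_ge0.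
Qed.

(** Expand |r x + 2 u|^2 >= 0. *)
Lemma dot_affine_ge g (r : R) (u x : 'cV[R]_g) :
  r ^+ 2 / 2 * dot x x - dot u u <= dot (r *: x + u) (r *: x + u).
Proof.
have := dot_norm_ge0 (r *: x + 2 *: u).
rewrite !dotDl !dotDr !dotZl !(dotC _ (r *: _)) !(dotC _ (2 *: _)) !dotZl.
rewrite (dotC u x); lra.
Qed.

Lemma normc_gauss_affine_le g (M : 'M[R[i]]_g) (r : R) (u : 'cV[R]_g) :
  re_posdef M -> 0 < r -> exists K a, 0 < a /\
    forall x, normc (gauss M (r *: x + u)) <= K * expR (- (a * dot x x)).
Proof.
move=> /re_posdef_coercive[c c0 cM] r0.
exists (expR (pi * c * dot u u)), (pi * c * (r ^+ 2 / 2)); split.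
  by rewrite !mulr_gt0 ?pi_gt0 ?exprn_gt0 ?invr_gt0.
move=> x; rewrite (le_trans (normc_gauss_le _ cM))// -expRD ler_expR.
have := ler_wpM2l (mulr_ge0 (pi_ge0 R) (ltW c0)) (dot_affine_ge r u x).
by move: (pi * c) => p; lra.
Qed.

Lemma Cintegrable_gauss g (M : 'M[R[i]]_g) (r : R) (u : 'cV[R]_g) :
  re_posdef M -> 0 < r ->
  Cintegrable (leb g) setT (fun x => gauss M (r *: colv x + u)).
Proof.
move=> Mp r0; have [K [a [a0 MK]]] := normc_gauss_affine_le u Mp r0.
have iG := integrable_scale K measurableT (integrable_gauss_tuple g a0).
apply: (Cintegrable_le _ _ iG) => //.
by apply: Cmeasurable_gauss => i; exact: measurable_affine.
Qed.

Lemma Cintegrable_gauss_tcons g (M : 'M[R[i]]_g.+1) (r : R) (u : 'cV[R]_g.+1) :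
  re_posdef M -> 0 < r ->
  Cintegrable (mu \x leb g)%E setT
    (fun z => gauss M (r *: colv (tcons z) + u)).
Proof.
move=> Mp r0; have [K [a [a0 MK]]] := normc_gauss_affine_le u Mp r0.
have iG := integrable_scale K measurableT
  (integrable_prod (integrable_gauss a0) (integrable_gauss_tuple g a0)).
apply: (Cintegrable_le _ _ iG) => // [|[t e] _].
  apply: (@Cmeasurable_comp _ _ _ _ R (fun x => gauss M (r *: colv x + u))
    (@tcons R g)); last exact: measurable_tcons.
  by apply: Cmeasurable_gauss => i; exact: measurable_affine.
rewrite (le_trans (MK _))// -expRD colv_tcons dot_col_mx mulrDr opprD.
by rewrite -expr2.
Qed.

(** Re (c^2) > 0 says that |Im c| < |Re c|; choose the sign of c. *)
Lemma sqrt_re_pos (a : R[i]) : 0 < complex.Re a ->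
  exists2 c, c ^+ 2 = a & `|complex.Im c| < complex.Re c.
Proof.
move=> a0; have sq c : c ^+ 2 = a -> `|complex.Im c| < `|complex.Re c|.
  move=> ca; move: a0; rewrite -ca expr2 ReM -!expr2 subr_gt0.
  by rewrite -(real_normK (num_real (complex.Im c)))
    -(real_normK (num_real (complex.Re c))) ltr_pXn2r ?nnegrE.
have := sqr_sqrtc a; move: (sqrtc a) => c ca; have {}sq := sq c ca.
have [c0|c0] := leP 0 (complex.Re c).
  by exists c => //; rewrite (ger0_norm c0) in sq.
exists (- c); first by rewrite sqrrN.
by rewrite ReN ImN normrN -(ltr0_norm c0); exact: sq.
Qed.

Lemma affine_col_mx g (r t : R) (v : 'cV[R]_g) (u : 'cV[R]_(1 + g)) :
  r *: col_mx t%:M v + u = col_mx (r * t + u 0 0)%:M (r *: v + dsubmx u).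
Proof.
rewrite [in LHS](col_mx_split u) scale_col_mx add_col_mx; congr col_mx.
by rewrite scale_scalar_mx -raddfD.
Qed.

(** The integral is a product of one-variable integrals, each of which ignores
    translations and is divided by [r] under dilation by [r].  Carrying this
    covariance through the induction replaces a change of variables in
    dimension [g], and compares the integrals themselves, whereas the
    determinant only determines them up to sign. *)
Lemma gaussian_integralE g (M : 'M[R[i]]_g) : re_posdef M ->
  exists2 z, z ^+ 2 * \det M = 1 & forall (r : R) (u : 'cV[R]_g), 0 < r ->
    Cintegral (leb g) setT (fun x => gauss M (r *: colv x + u)) =
    (r ^- g)%:C * z.
Proof.
elim: g M => [|g IH] M Mpos.
  exists 1; first by rewrite det_mx00 expr1n mulr1.
  move=> r u r0; rewrite Cintegral_lebesgue_tuple0; last first.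
    by apply: Cmeasurable_gauss => i; exact: measurable_affine.
  by rewrite /gauss quadE big_ord0 mulr0 oppr0 expC0 expr0 invr1 mulr1.
have [a0 Spos] := @re_posdef_schur R g M Mpos.
have Ms := Mpos.1.
have M0 : M 0 0 != 0 by apply: contraTneq a0 => ->; rewrite ltxx.
have [c ca cre] := sqrt_re_pos a0.
have c0 : c != 0 by apply: contraNneq M0 => c0; rewrite -ca c0 expr0n.
have [z zS zI] := IH _ Spos.
exists (c^-1 * z).
  rewrite (@det_schur _ g M Ms M0) exprMn exprVn ca mulrACA mulVf// mul1r//.
move=> r u r0.
set f := fun x => _.
have mf : Cmeasurable setT f.
  by apply: Cmeasurable_gauss => i; exact: measurable_affine.
pose b := dlsubmx (M : 'M[R[i]]_(1 + g)).
pose u' := dsubmx (u : 'cV[R]_(1 + g)).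
pose W e := c * ((u 0 0)%:C +
  (M 0 0)^-1 * dot b (map_mx (fun r => r%:C) (r *: colv e + u'))).
have fE t e : f (tcons (t, e)) =
    gauss (schur_complement (M : 'M[R[i]]_(1 + g))) (r *: colv e + u') *
    expC (- pi%:C * (c * r%:C * t%:C + W e) ^+ 2).
  rewrite /f /gauss -expCD; congr expC.
  have -> : r *: colv (tcons (t, e)) + u =
      col_mx (r * t + u 0 0)%:M (r *: colv e + u').
    by rewrite colv_tcons; exact: affine_col_mx.
  rewrite (@quad_schur _ g M _ _ Ms M0) -/b /W -ca (realCD (r * t)) (realCM r).
  by move: (pi%:C) => p; field.
have ci : `|complex.Im (c * r%:C)| < complex.Re (c * r%:C).
  rewrite ReM ImM /= !mulr0 subr0 add0r normrM (gtr0_norm r0).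
  by rewrite ltr_pM2r.
have inner e : Cintegrable mu setT
      (fun t => expC (- pi%:C * (c * r%:C * t%:C + W e) ^+ 2)) /\
    Cintegral mu setT (fun t => f (tcons (t, e))) = (c * r%:C)^-1 *
    gauss (schur_complement (M : 'M[R[i]]_(1 + g))) (r *: colv e + u').
  have [i1 i2] := complex_gaussian_integral (W e) ci; split => //.
  under [LHS]eq_Cintegral do rewrite fE.
  by rewrite CintegralZ// i2 mulrC.
have ft := Cintegrable_gauss_tcons u Mpos r0.
rewrite (Cintegral_lebesgue_tupleS mf ft) Cfubini//.
transitivity (Cintegral (leb g) setT (fun e => (c * r%:C)^-1 *
    gauss (schur_complement (M : 'M[R[i]]_(1 + g))) (r *: colv e + u'))).
  by apply: eq_Cintegral => e _; have [_ ->] := inner e.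
rewrite CintegralZ//; last exact: Cintegrable_gauss.
have rV : (r^-1)%:C = (r%:C)^-1 by rewrite fmorphV.
rewrite zI// [in RHS]exprS [in RHS]invfM realCM rV invfM.
by move: ((r ^- g)%:C) (r%:C)^-1 (c^-1) => x y x'; ring.
Qed.

End gaussian_integral.

(** * Translation invariance and unfolding along the integer lattice *)

Section translation.
Context (R : realType).
Local Notation mu :=
  (lebesgue_measure : {sigma_finite_measure set (measurableTypeR R) -> \bar R}).
Local Notation leb := (lebesgue_tuple R).

Lemma measurable_addr (c : R) :
  measurable_fun setT (fun x : measurableTypeR R => x + c : measurableTypeR R).
Proof. exact: measurable_funD. Qed.

Lemma lebesgue_measure_shift (c : R) (A : set (measurableTypeR R)) :
  measurable A -> mu ((fun x => x + c) @^-1` A) = mu A.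
Proof.
move=> mA.
pose nu : {measure set (measurableTypeR R) -> \bar R} :=
  measure_function_pushforward__canonical__measure_function_Measure mu
    (measurable_addr c).
rewrite -[LHS]/(nu A) -[RHS]/(lebesgue_measure A).
apply/esym; apply: (@lebesgue_measure_unique R nu) => // X [[a b] _ <-].
rewrite -[RHS]/(mu ((fun x => x + c) @^-1` `]a, b])).
rewrite (_ : _ @^-1` _ = `]a - c, b - c]%classic); last first.
  by apply/seteqP; split => x /=; rewrite !in_itv/= ltrBlDr lerBrDr.
rewrite /= !lebesgue_measure_itv/= !lte_fin ltrBlDr subrK.
by case: ifP => // _; rewrite -!EFinB; congr EFin; ring.
Qed.

Definition tshift n (a : 'cV[R]_n) (x : n.-tuple R) : n.-tuple R :=
  [tuple tnth x i + a i 0 | i < n].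

Lemma colv_tshift n (a : 'cV[R]_n) x : colv (tshift a x) = colv x + a.
Proof. by apply/matrixP => i j; rewrite !ord1 !mxE tnth_mktuple. Qed.

Lemma colv_inj n : injective (@colv R n).
Proof.
by move=> x y /matrixP xy; apply: eq_from_tnth => i; have := xy i 0; rewrite !mxE.
Qed.

Lemma measurable_tshift n (a : 'cV[R]_n) : measurable_fun setT (tshift a).
Proof.
apply/measurable_fun_tnthP => i; rewrite /comp.
under eq_fun do rewrite tnth_mktuple.
by apply: measurable_funD => //; exact: measurable_tnth.
Qed.

(** Induction on [n], by slices along the first coordinate. *)
Lemma lebesgue_tuple_shift n (a : 'cV[R]_n) (A : set (n.-tuple R)) :
  measurable A -> leb n (tshift a @^-1` A) = leb n A.
Proof.
elim: n a A => [|n IH] a A mA.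
  rewrite (_ : tshift a = id) ?preimage_id//.
  by apply/funext => x; rewrite [LHS]tuple0 [RHS]tuple0.
pose a' := dsubmx (a : 'cV[R]_(1 + n)).
have E t e : tshift a (tcons (t, e)) = tcons (t + a 0 0, tshift a' e).
  apply: colv_inj; rewrite colv_tshift !colv_tcons colv_tshift.
  have := affine_col_mx 1 t (colv e) (a : 'cV[R]_(1 + n)).
  by rewrite !scale1r mul1r.
have mtA : measurable (@tcons R n @^-1` A).
  by rewrite -[X in measurable X]setTI; exact: measurable_tcons.
rewrite -[LHS]/(\int[mu]_t leb n
  (xsection (@tcons R n @^-1` (tshift a @^-1` A)) t))%E.
rewrite -[RHS]/(\int[mu]_t leb n (xsection (@tcons R n @^-1` A) t))%E.
pose phi t := leb n (xsection (@tcons R n @^-1` A) t).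
transitivity (\int[mu]_t phi (t + a 0%R 0%R)%R)%E.
  apply: eq_integral => t _; rewrite /phi -[RHS](IH a'); last first.
    exact: measurable_xsection.
  have -> // : xsection (@tcons R n @^-1` (tshift a @^-1` A)) t =
      tshift a' @^-1` (xsection (@tcons R n @^-1` A) (t + a 0 0)).
  rewrite [LHS]xsectionE [in RHS]xsectionE.
  by apply/funext => e; rewrite /preimage /= E.
transitivity (\int[pushforward mu (fun x : measurableTypeR R =>
    (x + a 0 0)%R : measurableTypeR R)]_t phi t)%E.
  rewrite ge0_integral_pushforward//; first exact: measurable_addr.
  apply: measurable_fun_xsection => //.
apply: eq_measure_integral => [|mf B mB _]; first exact: measurable_addr.
exact: lebesgue_measure_shift.
Qed.

Lemma Cintegral_tshift n (a : 'cV[R]_n) (f : n.-tuple R -> R[i]) :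
  Cmeasurable setT f -> Cintegrable (leb n) setT (fun x => f (tshift a x)) ->
  Cintegral (leb n) setT (fun x => f (tshift a x)) = Cintegral (leb n) setT f.
Proof.
have key (p : n.-tuple R -> R) : measurable_fun setT p ->
    (leb n).-integrable setT (fun x => (p (tshift a x))%:E) ->
    (\int[leb n]_x p (tshift a x) = \int[leb n]_x p x)%R.
  move=> mp ip; congr fine; apply/esym.
  have := @integral_pushforward _ _ _ _ R _ (measurable_tshift a) (leb n) setT
    (EFin \o p).
  rewrite preimage_setT => /(_ _ ip measurableT) <-; last exact/measurable_EFinP.
  apply/esym; apply: eq_measure_integral => [|mf B mB _].
    exact: measurable_tshift.
  exact: lebesgue_tuple_shift.
move=> [m1 m2] [i1 i2]; apply: complex_ext => /=.
  exact: (key (fun x => complex.Re (f x))).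
exact: (key (fun x => complex.Im (f x))).
Qed.

End translation.

Section unfolding.
Context (R : realType).
Local Notation mu :=
  (lebesgue_measure : {sigma_finite_measure set (measurableTypeR R) -> \bar R}).
Local Notation leb := (lebesgue_tuple R).
Local Notation cube n := (@unit_cube R n).

Definition box (J : set R) n : set (n.-tuple R) :=
  [set t | forall i, J (tnth t i)].
Arguments box J n : clear implicits.

Lemma measurable_box (J : set (measurableTypeR R)) n :
  measurable J -> measurable (box J n).
Proof.
move=> mJ; rewrite (_ : box J n =
    \bigcap_(i in [set: 'I_n]) ((fun t => tnth t i) @^-1` J)).
  apply: fin_bigcap_measurable => [|i _]; first exact: finite_finset.
  by rewrite -[X in measurable X]setTI; exact: measurable_tnth.
by apply/seteqP; split => t /= tJ i; [move=> _; exact: tJ|exact: (tJ i)].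
Qed.

Lemma tcons_box (J : set (measurableTypeR R)) n :
  @tcons R n @^-1` (box J n.+1) = J `*` box J n.
Proof.
apply/seteqP; split => -[t e] /=.
  move=> te; split; first by have := te ord0; rewrite (tnth_nth t).
  move=> i; have := te (lift ord0 i).
  by rewrite (tnth_nth t) /= -tnth_nth.
move=> [Jt Je] i; rewrite (tnth_nth t); case: (unliftP ord0 i) => [j|] -> //=.
by rewrite -tnth_nth.
Qed.

Lemma lebesgue_tuple_box (J : set (measurableTypeR R)) n :
  measurable J -> mu J = 1%E -> leb n (box J n) = 1%E.
Proof.
move=> mJ muJ; elim: n => [|n IH].
  rewrite /= diracE mem_set// => -[].
  by [].
rewrite -[LHS]/((mu \x leb n)%E (@tcons R n @^-1` (box J n.+1))) tcons_box.
rewrite product_measure1E//; last exact: measurable_box.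
by rewrite -[X in (_ * X)%E]/(leb n (box J n)) IH -[X in (X * _)%E]/(mu J) muJ mule1.
Qed.

Lemma unit_cubeE n : cube n = box `[0, 1] n.
Proof. by []. Qed.

Local Notation half n := (box `[0, 1[ n).

Lemma measurable_unit_cube n : measurable (cube n).
Proof. by rewrite unit_cubeE; apply: measurable_box; exact: measurable_itv. Qed.

Lemma lebesgue_unit_cube n : leb n (cube n) = 1%E.
Proof.
rewrite unit_cubeE; apply: lebesgue_tuple_box; first exact: measurable_itv.
by rewrite /= lebesgue_measure_itv/= lte_fin ltr01 -EFinB subr0.
Qed.

(** Unlike the closed cube, the half-open one tiles the space under integer
    translations; the two have measure 1. *)
Lemma Cintegral_unit_cube_half n (f : n.-tuple R -> R[i]) :
  Cintegrable (leb n) (cube n) f ->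
  Cintegral (leb n) (cube n) f = Cintegral (leb n) (half n) f.
Proof.
have mC := @measurable_unit_cube n.
have mH : measurable (half n) by apply: measurable_box; exact: measurable_itv.
have HC : half n `<=` cube n.
  by move=> t ht i; exact: subset_itv_co_cc (ht i).
have lH : leb n (half n) = 1%E.
  apply: lebesgue_tuple_box; first exact: measurable_itv.
  by rewrite /= lebesgue_measure_itv/= lte_fin ltr01 -EFinB subr0.
have null : leb n (cube n `\` half n) = 0%E.
  have lC := @lebesgue_unit_cube n.
  rewrite measureD//; last by rewrite [X in (X < _)%E]lC ltry.
  by rewrite (setIidr HC) [X in (X - _)%E]lC [X in (_ - X)%E]lH subee.
have CD : cube n `\` (cube n `\` half n) = half n.
  by rewrite setDD setIidr.
have mD : measurable (cube n `\` half n) by exact: measurableD.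
have key (p : n.-tuple R -> R) :
    (leb n).-integrable (cube n) (fun x => (p x)%:E) ->
    (\int[leb n]_(x in cube n) p x = \int[leb n]_(x in half n) p x)%R.
  move=> ip; congr fine; rewrite -[in RHS]CD; exact: negligible_integral.
by move=> [f1 f2]; apply: complex_ext; exact: key.
Qed.

Lemma mem_half_shift n (m : 'cV[int]_n) (y : n.-tuple R) :
  half n (tshift (intv R m) y) <-> m = \col_i (- Num.floor (tnth y i)).
Proof.
have E i : (0 <= tnth y i + (m i 0)%:~R < 1) = (Num.floor (tnth y i) == - m i 0).
  rewrite floor_eq intrD intrN -[1%:~R]/(1 : R).
  by apply/idP/idP => /andP[? ?]; apply/andP; split; lra.
split => [hy|mE i].
  apply/matrixP => i j; rewrite ord1 !mxE.
  have := hy i; rewrite /= tnth_mktuple mxE in_itv/= E => /eqP ->.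
  by rewrite opprK.
by rewrite /= tnth_mktuple mxE in_itv/= E mE mxE opprK.
Qed.

(** The N-th sum is the integral of [H] over the tiles with index in [A N];
    these integrands are dominated by the modulus of [H]. *)
Lemma Cintegral_unfold n (H : 'cV[R]_n -> R[i]) (A : nat -> seq 'cV[int]_n) :
  (forall N, uniq (A N)) ->
  (forall m, exists N0, forall N, (N0 <= N)%N -> m \in A N) ->
  (forall a, Cintegrable (leb n) setT (fun y => H (colv y + a))) ->
  Ccvg (fun N => \sum_(m <- A N)
      Cintegral (leb n) (cube n) (fun y => H (colv y - intv R m)))
    (Cintegral (leb n) setT (fun y => H (colv y))).
Proof.
move=> uA exA iH.
have iH0 : Cintegrable (leb n) setT (fun y => H (colv y)).
  by have := iH 0; under eq_fun do rewrite addr0.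
have mH0 := Cintegrable_measurable iH0.
have mh : measurable (half n) by apply: measurable_box; exact: measurable_itv.
(* [F m] is [H] restricted to the tile moved into the cube by m. *)
pose F m y : R[i] := (\1_(half n) (tshift (intv R m) y))%:C * H (colv y).
have iF m : Cintegrable (leb n) setT (F m).
  apply: (Cintegrable_le _ _ (integrable_normc _ iH0)) => // [|y _].
    apply: CmeasurableM => //; apply: Cmeasurable_real.
    have m1 : measurable_fun setT (\1_(half n) : n.-tuple R -> R).
      exact: measurable_indic.
    by apply: (measurableT_comp m1); exact: measurable_tshift.
  rewrite normcM normcR ler_piMl ?normc_ge0// indicE.
  by case: (_ \in _); rewrite ?normr1 ?normr0.
have FE m : Cintegral (leb n) (cube n) (fun y => H (colv y - intv R m)) =
    Cintegral (leb n) setT (F m).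
  have iHm : Cintegrable (leb n) (cube n) (fun y => H (colv y - intv R m)).
    have [i1 i2] := iH (- intv R m).
    by split; apply: (integrableS measurableT (@measurable_unit_cube n)).
  have FG y : F m (tshift (- intv R m) y) =
      (\1_(half n) y)%:C * H (colv y - intv R m).
    rewrite /F colv_tshift; congr ((\1_(half n) _)%:C * _).
    by apply: colv_inj; rewrite !colv_tshift subrK.
  rewrite Cintegral_unit_cube_half// Cintegral_mkcond.
  rewrite -(@Cintegral_tshift R n (- intv R m) (F m)); last 2 first.
  - exact: Cintegrable_measurable (iF m).
  - rewrite (funext FG); apply/(Cintegrable_mkcond _ _ mh).
    have [i1 i2] := iH (- intv R m).
    by split; apply: (integrableS measurableT mh).
  by rewrite (funext FG).
under eq_fun do under eq_bigr do rewrite FE.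
have sumF N : Cintegrable (leb n) setT (fun y => \sum_(m <- A N) F m y) /\
    Cintegral (leb n) setT (fun y => \sum_(m <- A N) F m y) =
    \sum_(m <- A N) Cintegral (leb n) setT (F m).
  exact: Cintegral_sum.
under eq_fun do rewrite -(sumF _).2.
pose mu_ (y : n.-tuple R) : 'cV[int]_n := \col_i (- Num.floor (tnth y i)).
have FmE N y : \sum_(m <- A N) F m y = ((mu_ y \in A N)%:R)%:C * H (colv y).
  have F1 m : F m y = ((m == mu_ y)%:R)%:C * H (colv y).
    rewrite /F indicE; congr ((nat_of_bool _)%:R%:C * _).
    by apply/idP/eqP; rewrite in_setE mem_half_shift.
  have [yA|yA] := boolP (mu_ y \in A N).
    rewrite (bigD1_seq (mu_ y))//= F1 eqxx big1 ?addr0// => m /negPf my.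
    by rewrite F1 my mul0r.
  rewrite mul0r big_seq big1// => m mA; rewrite F1.
  by case: eqP => [my|]; rewrite ?mul0r//; rewrite -my mA in yA.
have [] // := Cdominated_convergence (mu := leb n) measurableT _
  (integrable_normc measurableT iH0)
  (f_ := fun N y => \sum_(m <- A N) F m y) (f := fun y => H (colv y)).
- by move=> N; exact: Cintegrable_measurable (sumF N).1.
- move=> N y _; rewrite FmE normcM normcR ler_piMl ?normc_ge0//.
  by case: (_ \in _); rewrite ?normr1 ?normr0.
- move=> y _; rewrite -[X in Ccvg _ X]mul1r.
  under eq_fun do rewrite FmE; apply: CcvgM (Ccvg_cst _).
  have [N0 yN0] := exA (mu_ y).
  split => /=; last exact: cvg_cst.
  by apply: cvg_near_cst; exists N0 => // N /= /yN0 ->.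
Qed.

End unfolding.

(** * Absolutely summable families of complex numbers *)

Section absolute_summability.
Context (R : realType) (I : choiceType).

Lemma fset_sum_split (V : nmodType) (p : I -> V) (A B : {fset I}) :
  (B `<=` A)%fset ->
  \sum_(i <- A) p i = \sum_(i <- B) p i + \sum_(i <- (A `\` B)%fset) p i.
Proof.
move=> BA; rewrite -big_cat /=; apply: perm_big; apply: uniq_perm.
- exact: fset_uniq.
- rewrite cat_uniq !fset_uniq andbT /=; apply/hasPn => i.
  by rewrite in_fsetD => /andP[].
- move=> i; rewrite mem_cat in_fsetD; case: (boolP (i \in B)) => //= iB.
  exact: (fsubsetP BA).
Qed.

(** Partial sums of nonnegative terms increase to their supremum. *)
Lemma nonneg_net_limit (p : I -> R) C : (forall i, 0 <= p i) ->
  (forall A : {fset I}, \sum_(i <- A) p i <= C) ->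
  exists L, forall e, 0 < e -> exists A0 : {fset I}, forall A : {fset I},
    (A0 `<=` A)%fset -> `|\sum_(i <- A) p i - L| <= e.
Proof.
move=> p0 pC; pose S := [set r | exists A : {fset I}, r = \sum_(i <- A) p i].
have hS : has_sup S.
  split; first by exists (\sum_(i <- fset0%fset) p i), fset0%fset.
  by exists C => _ [A ->]; exact: pC.
exists (sup S) => e e0; have [_ [A0 ->] A0e] := sup_adherent e0 hS.
exists A0 => A A0A; rewrite ler_norml; apply/andP; split.
  rewrite lerBrDl (le_trans (ltW A0e))// (fset_sum_split p A0A) lerDl.
  by rewrite sumr_ge0.
rewrite lerBlDr ler_wpDl ?(ltW e0)//; apply: ub_le_sup; first exact: hS.2.
by exists A.
Qed.

Lemma real_net_limit (p : I -> R) C :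
  (forall A : {fset I}, \sum_(i <- A) `|p i| <= C) ->
  exists L, forall e, 0 < e -> exists A0 : {fset I}, forall A : {fset I},
    (A0 `<=` A)%fset -> `|\sum_(i <- A) p i - L| <= e.
Proof.
move=> pC.
have le_sum (q : I -> R) : (forall i, q i <= `|p i|) ->
    forall A : {fset I}, \sum_(i <- A) q i <= C.
  by move=> qp A; rewrite (le_trans _ (pC A))// ler_sum.
have n1 i : p i <= `|p i| by exact: ler_norm.
have n2 i : - p i <= `|p i| by rewrite -normrN ler_norm.
have [|| L1 h1] := @nonneg_net_limit (fun i => (`|p i| + p i) / 2) C.
- by move=> i; have := n2 i; lra.
- by apply: le_sum => i; have := n1 i; lra.
have [|| L2 h2] := @nonneg_net_limit (fun i => (`|p i| - p i) / 2) C.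
- by move=> i; have := n1 i; lra.
- by apply: le_sum => i; have := n2 i; lra.
exists (L1 - L2) => e e0; have e2 : 0 < e / 2 by rewrite divr_gt0.
have [A1 hA1] := h1 _ e2; have [A2 hA2] := h2 _ e2.
exists (A1 `|` A2)%fset => A; rewrite fsubUset => /andP[/hA1 a1 /hA2 a2].
have -> : \sum_(i <- A) p i - (L1 - L2) =
    (\sum_(i <- A) (`|p i| + p i) / 2 - L1)
    - (\sum_(i <- A) (`|p i| - p i) / 2 - L2).
  rewrite (eq_bigr (fun i => (`|p i| + p i) / 2 - (`|p i| - p i) / 2)).
    by rewrite sumrB; ring.
  by move=> i _; field.
by rewrite (le_trans (ler_normB _ _))//; lra.
Qed.

(** By completeness of the reals, applied to the positive and negative parts of
    the coordinates, the net of partial sums converges; hence [Csum] is its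
    limit and not a default value. *)
Lemma Csum_limit (f : I -> R[i]) C :
  (forall A : {fset I}, \sum_(i <- A) normc (f i) <= C) ->
  forall e, 0 < e -> exists A0 : {fset I}, forall A : {fset I},
    (A0 `<=` A)%fset -> normc (\sum_(i <- A) f i - Csum f) <= e.
Proof.
move=> fC.
have [|L1 h1] := @real_net_limit (fun i => complex.Re (f i)) C.
  by move=> A; rewrite (le_trans _ (fC A))// ler_sum// => i _; exact: Re_le_normc.
have [|L2 h2] := @real_net_limit (fun i => complex.Im (f i)) C.
  by move=> A; rewrite (le_trans _ (fC A))// ler_sum// => i _; exact: Im_le_normc.
have lim_f e : 0 < e -> exists A0 : {fset I}, forall A : {fset I},
    (A0 `<=` A)%fset -> normc (\sum_(i <- A) f i - (L1 +i* L2)) <= e.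
  move=> e0; have e2 : 0 < e / 2 by rewrite divr_gt0.
  have [A1 hA1] := h1 _ e2; have [A2 hA2] := h2 _ e2.
  exists (A1 `|` A2)%fset => A; rewrite fsubUset => /andP[/hA1 a1 /hA2 a2].
  rewrite (le_trans (normc_le_ReIm _))// ReD ImD ReN ImN Re_sum Im_sum /=; lra.
suff -> : Csum f = L1 +i* L2 by [].
rewrite /Csum /summability.sum; apply: (@cvg_lim R[i]^o).
  exact: norm_hausdorff.
  exact: summability.totally_filter.
have FF := @summability.totally_filter I.
apply/cvgrPdist_le => /= eps eps0.
have epsE : eps = (complex.Re eps)%:C.
  by move: eps0; rewrite ltcE => /andP[/eqP i0 _]; apply: complex_ext.
have e0 : 0 < complex.Re eps by move: eps0; rewrite {1}epsE ltcR.
have [A0 hA0] := lim_f _ e0.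
exists A0 => // A /= A0A; rewrite distrC epsE.
rewrite /summability.partial_sum -(big_seq_fsetE _ _ xpredT (fun i => f i)) /=.
rewrite -[X in X <= _]/((normc (\sum_(i <- A) f i - (L1 +i* L2)))%:C) lecR.
exact: hA0.
Qed.

Lemma Csum_cvg (f : I -> R[i]) C (A : nat -> {fset I}) :
  (forall B : {fset I}, \sum_(i <- B) normc (f i) <= C) ->
  (forall i, exists N0, forall N, (N0 <= N)%N -> i \in A N) ->
  Ccvg (fun N => \sum_(i <- A N) f i) (Csum f).
Proof.
move=> fC exA.
have cofinal (B : {fset I}) : exists N0, forall N, (N0 <= N)%N -> (B `<=` A N)%fset.
  have [N0_ N0P] := choice exA; exists (\max_(i <- B) N0_ i) => N BN.
  apply/fsubsetP => i iB; apply: N0P; apply: leq_trans BN.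
  exact: leq_bigmax_seq.
have near e : 0 < e -> \forall N \near \oo,
    normc (\sum_(i <- A N) f i - Csum f) <= e.
  move=> /(Csum_limit fC)[B hB]; have [N0 hN0] := cofinal B.
  by exists N0 => // N /= /hN0 /hB.
split; apply/cvgrPdist_le => e /near; apply: filterS => N h; rewrite distrC.
  by rewrite -ReN -ReD (le_trans (Re_le_normc _)).
by rewrite -ImN -ImD (le_trans (Im_le_normc _)).
Qed.

End absolute_summability.

(** * Gaussian sums over the integer lattice *)

Section lattice_bound.
Context (R : realType).

Lemma ler_sum_subset (I : eqType) (p : I -> R) (s t : seq I) :
  (forall i, 0 <= p i) -> uniq s -> {subset s <= t} ->
  \sum_(i <- s) p i <= \sum_(i <- t) p i.
Proof.
move=> p0; elim: s t => [|x s IH] t /=; first by rewrite big_nil sumr_ge0.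
move=> /andP[xs us] st.
have xt : x \in t by apply: st; rewrite mem_head.
rewrite big_cons (perm_big _ (perm_to_rem xt)) big_cons lerD2l; apply: IH => // y ys.
have := st y; rewrite in_cons ys orbT (perm_mem (perm_to_rem xt)) in_cons.
by move=> /(_ isT)/orP[/eqP yx|//]; rewrite yx (negbTE xs) in ys.
Qed.

Lemma geometric_sum_le (q : R) n : 0 <= q < 1 -> \sum_(j < n) q ^+ j <= (1 - q)^-1.
Proof.
move=> /andP[q0 q1]; have q1' : 0 < 1 - q by rewrite subr_gt0.
rewrite -[(1 - q)^-1]mul1r ler_pdivlMr//.
have := subrX1 q n; rewrite -opprB -[X in _ = X * _]opprB mulNr => /oppr_inj.
by rewrite mulrC => <-; rewrite gerBl exprn_ge0.
Qed.

(** The sum over a box factors into one-variable sums.  Signs and absolute values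
    of the coordinates enumerate the box, with repetitions at 0, whence the
    factor 2. *)
Lemma sum_geometric_box g (q : R) (B : {fset 'cV[int]_g}) : 0 <= q < 1 ->
  \sum_(m <- B) \prod_i q ^+ `|m i 0%R|%N <= (2 / (1 - q)) ^+ g.
Proof.
move=> q01; have /andP[q0 q1] := q01.
pose N := (\max_(m <- B) \max_i `|m i 0%R|%N)%N.
pose mf (f : {ffun 'I_g -> bool * 'I_N.+1}) : 'cV[int]_g :=
  \col_i (if (f i).1 then - ((f i).2 : nat)%:Z else ((f i).2 : nat)%:Z).
have absf f i : `|mf f i 0%R|%N = (f i).2.
  by rewrite mxE; case: (f i).1; rewrite ?abszN absz_nat.
have P0 (m : 'cV[int]_g) : 0 <= \prod_i q ^+ `|m i 0%R|%N.
  by apply: prodr_ge0 => i _; exact: exprn_ge0.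
apply: (@le_trans _ _
    (\sum_(m <- [seq mf f | f <- index_enum _]) \prod_i q ^+ `|m i 0%R|%N)).
  apply: ler_sum_subset => // m mB.
  have mN i : (`|m i 0%R|%N < N.+1)%N.
    rewrite ltnS; apply: leq_trans (leq_bigmax_seq m mB isT).
    exact: (leq_bigmax i).
  apply/mapP; exists [ffun i => (m i 0 < 0, Ordinal (mN i))].
    exact: mem_index_enum.
  apply/matrixP => i j; rewrite ord1 !mxE ffunE /=.
  by case: ltrP => m0; [rewrite ltz0_abs ?opprK|rewrite gez0_abs].
rewrite big_map.
under eq_bigr do under eq_bigr do rewrite absf.
rewrite -(bigA_distr_bigA (fun (i : 'I_g) (j : bool * 'I_N.+1) => q ^+ j.2)) /=.
rewrite prodr_const card_ord lerXn2r ?nnegrE//.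
- by apply: sumr_ge0 => j _; exact: exprn_ge0.
- by rewrite divr_ge0// subr_ge0 ltW.
rewrite -(pair_bigA _ (fun (b : bool) (j : 'I_N.+1) => q ^+ j)) /=.
rewrite big_bool /= -mulr2n -[leLHS]mulr_natl ler_wpM2l//.
exact: geometric_sum_le.
Qed.

(** With x = y - (n + s), the inequalities x^2 >= 2 |x| - 1 and
    |n| <= |x| + 1 + |s| trade Gaussian decay for geometric decay in n, uniformly
    in [y]. *)
Lemma gauss_le_geometric (a s y : R) (n : int) : 0 < a -> 0 <= y <= 1 ->
  expR (- (a * (y - (n%:~R + s)) ^+ 2)) <=
  expR (a * (2 * (1 + `|s|) + 1)) * expR (- (2 * a)) ^+ `|n|%N.
Proof.
move=> a0 /andP[y0 y1]; rewrite -expRM_natl -expRD ler_expR.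
have -> : `|n|%N%:R = `|n%:~R| :> R by rewrite -intr_norm -pmulrn /= natr_absz.
set x := y - _.
have nx : `|n%:~R| <= `|x| + (1 + `|s|).
  have -> : n%:~R = - x + (y - s) by rewrite /x; ring.
  rewrite (le_trans (ler_normD _ _))// normrN lerD2l (le_trans (ler_normB _ _))//.
  by rewrite lerD2r ger0_norm.
have x2 : 2 * `|x| - 1 <= x ^+ 2.
  rewrite -(real_normK (num_real x)) -subr_ge0.
  by rewrite (_ : _ - _ = (`|x| - 1) ^+ 2) ?sqr_ge0//; ring.
have h1 := ler_wpM2l (ltW a0) x2; have h2 := ler_wpM2l (ltW a0) nx; lra.
Qed.

Lemma lattice_gauss_bound g (a : R) (s : 'cV[R]_g) : 0 < a ->
  exists C, forall (y : 'cV[R]_g) (B : {fset 'cV[int]_g}),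
    (forall i, 0 <= y i 0 <= 1) ->
    \sum_(m <- B) expR (- (a * dot (y - (intv R m + s)) (y - (intv R m + s)))) <= C.
Proof.
move=> a0; pose q := expR (- (2 * a)).
have q01 : 0 <= q < 1.
  by rewrite expR_ge0 /q expR_lt1 oppr_lt0 mulr_gt0.
pose K := \prod_i expR (a * (2 * (1 + `|s i 0|) + 1)).
exists (K * (2 / (1 - q)) ^+ g) => y B yI.
apply: le_trans (ler_wpM2l _ (sum_geometric_box B q01)); last first.
  by apply: prodr_ge0 => i _; exact: expR_ge0.
rewrite mulr_sumr ler_sum// => m _; rewrite /K -big_split /= dotE mulr_sumr -sumrN.
rewrite expR_sum ler_prod// => i _; rewrite expR_ge0 /= !mxE -expr2.
exact: gauss_le_geometric.
Qed.

End lattice_bound.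

(** * Characters of the torus *)

Section characters.
Context (R : realType).
Local Notation mu :=
  (lebesgue_measure : {sigma_finite_measure set (measurableTypeR R) -> \bar R}).
Local Notation leb := (lebesgue_tuple R).
Local Notation cube n := (@unit_cube R n).

Definition character (r : R) : R[i] := expC (2 * pi%:C * 'i * r%:C).

Lemma characterD r s : character (r + s) = character r * character s.
Proof. by rewrite /character -expCD realCD mulrDr. Qed.

Lemma character_int (n : int) : character n%:~R = 1.
Proof.
rewrite /character -[RHS](expC_2pi_int R n); congr expC.
rewrite rmorph_int; move: (pi%:C) => p; ring.
Qed.

Lemma normc_character r : normc (character r) = 1.
Proof.
rewrite normc_expC (_ : complex.Re _ = 0) ?expR0//.
by rewrite !(ReM, ImM) /=; move: (@pi R) => p; ring.
Qed.

Lemma Cmeasurable_character d (T : measurableType d) (f : T -> R) :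
  measurable_fun setT f -> Cmeasurable setT (fun x => character (f x)).
Proof.
move=> mf; apply: Cmeasurable_expC; apply: CmeasurableM.
  exact: Cmeasurable_cst.
exact: Cmeasurable_real.
Qed.

Lemma Cintegral_character_itv (n : int) :
  Cintegral mu `[0, 1] (fun t => character (n%:~R * t)) = (n == 0)%:R.
Proof.
have [->|n0] := eqVneq n 0.
  rewrite (_ : (fun t => _) = fun=> 1).
    apply: complex_ext => /=; last by rewrite /Rintegral integral0.
    rewrite Rintegral_cst//=.
    by rewrite lebesgue_measure_itv/= lte_fin ltr01 -EFinB /= subr0 mulr1.
  by apply/funext => t; rewrite mul0r -(mulr0z 1) character_int.
have w0 : 2 * pi%:C * 'i * n%:~R != 0 :> R[i].
  rewrite !mulf_neq0 ?pnatr_eq0 ?intr_eq0//.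
    by apply/eqP => /(congr1 (@complex.Re R)) /= /eqP; rewrite gt_eqF ?pi_gt0.
  by apply/eqP => /(congr1 (@complex.Im R)) /= /eqP; rewrite oner_eq0.
set w := 2 * pi%:C * 'i * n%:~R in w0.
have cE t : character (n%:~R * t) = expC (0 + t%:C * w).
  rewrite /character add0r realCM rmorph_int /w; congr expC.
  by move: (pi%:C) => p; ring.
have d1 (t : R) : Cderiv (fun t => expC (0 + t%:C * w)) t (w * expC (0 + t%:C * w)).
  exact: Cderiv_expC (Cderiv_affine 0 w t).
rewrite (funext cE) (@Cintegral_FTC R (fun t => w^-1 * expC (0 + t%:C * w)) _ 0 1)//.
- rewrite -!cE mulr1 mulr0 character_int -(mulr0z 1) character_int subrr//.
- by move=> t; exists (w * expC (0 + t%:C * w)).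
- move=> t; apply: Cderiv_eq (CderivM (Cderiv_cst w^-1 t) (d1 t)) _.
  by rewrite mul0r add0r mulKf.
Qed.

Lemma measurable_dot_colv g (a : 'cV[R]_g) :
  measurable_fun setT (fun x : g.-tuple R => dot a (colv x)).
Proof.
under eq_fun do rewrite dotE; apply: measurable_sum => i.
by apply: measurable_funM => //; exact: measurable_colv.
Qed.

Lemma Cintegrable_cube g (f : g.-tuple R -> R[i]) K : Cmeasurable setT f ->
  (forall x, cube g x -> normc (f x) <= K) -> Cintegrable (leb g) (cube g) f.
Proof.
move=> [m1 m2] fK; have mC := @measurable_unit_cube R g.
have [] // := @normc_Cintegral_le _ _ R (leb g) (cube g) f K mC.
- by rewrite [X in (X < _)%E]lebesgue_unit_cube ltry.
- by split; apply: measurable_funTS.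
Qed.

(** The integral is the product of the integrals over the coordinates. *)
Lemma Cintegral_character_cube g (n : 'cV[int]_g) :
  Cintegral (leb g) (cube g) (fun x => character (dot (intv R n) (colv x))) =
  (n == 0)%:R.
Proof.
have mf h (a : 'cV[int]_h) : Cmeasurable setT
    (fun x : h.-tuple R => character (dot (intv R a) (colv x))).
  by apply: Cmeasurable_character; exact: measurable_dot_colv.
have fi h (a : 'cV[int]_h) : Cintegrable (leb h) (cube h)
    (fun x : h.-tuple R => character (dot (intv R a) (colv x))).
  by apply: (@Cintegrable_cube _ _ 1) => // x _; rewrite normc_character.
elim: g n => [|g IH] n.
  rewrite Cintegral_mkcond Cintegral_lebesgue_tuple0.
    rewrite indicE mem_set; last by case.
    rewrite dotE big_ord0 -(mulr0z 1) character_int mulr1.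
    by rewrite [n]flatmx0 eqxx.
  have /(Cintegrable_mkcond _ _ (@measurable_unit_cube R 0)) := fi _ n.
  exact: Cintegrable_measurable.
pose n' := dsubmx (n : 'cV[int]_(1 + g)).
have mI : measurable (`[0, 1] : set (measurableTypeR R)) by exact: measurable_itv.
have i1 : Cintegrable mu `[0, 1] (fun t => character ((n 0 0)%:~R * t)).
  have [] // := @normc_Cintegral_le _ _ R mu `[0, 1]
    (fun t => character ((n 0 0)%:~R * t)) 1.
  - by rewrite /= lebesgue_measure_itv/= lte_fin ltr01 -EFinB ltry.
  - have [] := @Cmeasurable_character _ (measurableTypeR R)
      (fun t : R => (n 0 0)%:~R * t) (mulrl_measurable _).
    by split; apply: measurable_funTS.
  - by move=> t _; rewrite normc_character.
have dE t e : dot (intv R n) (colv (tcons (t, e))) =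
    (n 0 0)%:~R * t + dot (intv R n') (colv e).
  have -> : intv R n = col_mx ((n 0 0)%:~R)%:M (intv R n') :> 'cV_(1 + g).
    rewrite [LHS](col_mx_split (intv R n : 'cV[R]_(1 + g))); congr col_mx.
      by rewrite mxE.
    by apply/matrixP => i j; rewrite !mxE.
  by rewrite colv_tcons; exact: dot_col_mx.
have nE : ((n == 0)%:R : R[i]) = (n 0 0 == 0)%:R * (n' == 0)%:R.
  rewrite -natrM mulnb; congr (nat_of_bool _)%:R.
  transitivity (((n 0 0)%:M == 0 :> 'M[int]_1) && (n' == 0)).
    rewrite -col_mx_eq0; congr (_ == _).
    exact: (col_mx_split (n : 'cV[int]_(1 + g))).
  congr (_ && _); apply/eqP/eqP => [/matrixP/(_ 0 0)|->]; last exact: raddf0.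
  by rewrite !mxE.
have [iP cP] := Cintegrable_prod mI (@measurable_unit_cube R g) i1 (fi _ n').
rewrite nE -(IH n') -(Cintegral_character_itv (n 0 0)) -cP.
pose f x := (\1_(cube g.+1) x)%:C * character (dot (intv R n) (colv x)).
have fE : (fun z => f (tcons z)) = fun z => (\1_(`[0, 1] `*` cube g) z)%:C *
    (character ((n 0 0)%:~R * z.1) * character (dot (intv R n') (colv z.2))).
  apply/funext => -[t e]; rewrite /f dE characterD; congr ((_)%:C * _).
  by rewrite unit_cubeE -tcons_box.
have mf1 : Cmeasurable setT f.
  have /(Cintegrable_mkcond _ _ (@measurable_unit_cube R g.+1)) := fi _ n.
  exact: Cintegrable_measurable.
have mIC : measurable ((`[0, 1] : set (measurableTypeR R)) `*` cube g).
  by apply: measurableX => //; exact: measurable_unit_cube.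
have fi2 : Cintegrable (mu \x leb g)%E setT (fun z => f (tcons z)).
  by rewrite fE; apply/(Cintegrable_mkcond _ _ mIC).
rewrite Cintegral_mkcond -/f (Cintegral_lebesgue_tupleS mf1 fi2) fE.
by rewrite [RHS]Cintegral_mkcond.
Qed.

End characters.

(** * The L2 pairing of two theta functions *)

Section theta_pairing.
Context (R : realType) (g k : nat).
Hypothesis k0 : (0 < k)%N.
Local Notation leb := (lebesgue_tuple R).
Local Notation cube n := (@unit_cube R n).
Implicit Types (Om : 'M[R[i]]_g) (l m : 'cV[int]_g).

Lemma quadZ (c : R[i]) (M : 'M[R[i]]_g) v : quad (c *: M) v = c * quad M v.
Proof. by rewrite /quad /dot -scalemxAl -scalemxAr mxE. Qed.

Lemma quadD (M N : 'M[R[i]]_g) v : quad (M + N) v = quad M v + quad N v.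
Proof. by rewrite /quad /dot mulmxDl mulmxDr mxE. Qed.

Lemma quadJ (M : 'M[R[i]]_g) v : quad (map_mx conjc M) v = conjc (quad M v).
Proof.
rewrite !quadE conjc_sum; apply: eq_bigr => i _.
rewrite conjcM conjc_real conjc_sum; congr (_ * _).
by apply: eq_bigr => j _; rewrite mxE conjcM conjc_real.
Qed.

Lemma quad_scale_arg (M : 'M[R[i]]_g) (r : R) v :
  quad M (r *: v) = (r ^+ 2)%:C * quad M v.
Proof.
rewrite !quadE mulr_sumr; apply: eq_bigr => i _.
rewrite mxE expr2 !realCM -!mulrA; congr (_ * _).
rewrite [RHS]mulrCA; congr (_ * _); rewrite mulr_sumr.
by apply: eq_bigr => j _; rewrite mxE realCM mulrCA.
Qed.

Lemma Im_quad (M : 'M[R[i]]_g) (v : 'cV[R]_g) :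
  complex.Im (quad M v) = dot v (map_mx (@complex.Im R) M *m v).
Proof.
rewrite quadE dotE Im_sum; apply: eq_bigr => i _.
rewrite mxE ImM /= mul0r addr0 Im_sum; congr (_ * _).
by apply: eq_bigr => j _; rewrite !mxE ImM /= mulr0 add0r.
Qed.

Lemma gaussD (M N : 'M[R[i]]_g) v : gauss (M + N) v = gauss M v * gauss N v.
Proof. by rewrite /gauss quadD mulrDr opprD expCD. Qed.

Lemma gaussJ (M : 'M[R[i]]_g) v : conjc (gauss M v) = gauss (map_mx conjc M) v.
Proof. by rewrite /gauss expCJ conjcN conjcM conjc_real quadJ. Qed.

Lemma characterJ (r : R) : conjc (character r) = character (- r).
Proof.
have iJ : conjc 'i = - 'i :> R[i] by apply: complex_ext; rewrite //= oppr0.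
rewrite /character expCJ !conjcM !conjc_real conjc_nat iJ realCN; congr expC.
by move: (pi%:C) => p; ring.
Qed.

(** The matrix N with exp (k pi i quad Om v) = exp (- pi quad N v). *)
Definition theta_form Om : 'M[R[i]]_g := - (k%:R * 'i) *: Om.

Lemma re_posdefD (M N : 'M[R[i]]_g) :
  re_posdef M -> re_posdef N -> re_posdef (M + N).
Proof.
move=> [Ms Mp] [Ns Np]; split; first by rewrite linearD /= Ms Ns.
by move=> v v0; rewrite quadD ReD addr_gt0 ?Mp ?Np.
Qed.

Lemma re_posdefJ (M : 'M[R[i]]_g) : re_posdef M -> re_posdef (map_mx conjc M).
Proof.
move=> [Ms Mp]; split; first by rewrite map_trmx Ms.
by move=> v /Mp; rewrite quadJ; case: (quad M v).
Qed.

Lemma re_posdef_theta_form Om : siegel Om -> re_posdef (theta_form Om).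
Proof.
move=> [Os Op]; split; first by rewrite /theta_form linearZ /= Os.
move=> v /Op; rewrite -Im_quad quadZ mulNr ReN ReM => q0.
rewrite ReM ImM -(rmorph_nat (real_complex R) k) /=.
have kR : 0 < k%:R :> R by rewrite ltr0n.
have := mulr_gt0 kR q0; lra.
Qed.

(** The terms of the theta series, split into the Gaussian in y and the
    character of x. *)
Definition theta_term l Om m (p : g.-tuple R * g.-tuple R) : R[i] :=
  gauss (theta_form Om) (colv p.2 - theta_shift R k l m) *
  character (k%:R * dot (theta_shift R k l m) (colv p.1)).

Lemma theta_funE l Om (p : g.-tuple R * g.-tuple R) :
  theta_fun k l Om (colv p.1) (colv p.2) =
  expC (- (k%:R * pi%:C * 'i * (dot (colv p.1) (colv p.2))%:C)) *
  Csum (fun m => theta_term l Om m p).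
Proof.
rewrite /theta_fun; congr (_ * Csum _); apply/funext => m.
rewrite /theta_term /gauss /character -expCD /theta_form quadZ realCM rmorph_nat.
by congr expC; move: (pi%:C) => q; ring.
Qed.

Lemma normc_theta_term l Om m p : normc (theta_term l Om m p) =
  normc (gauss (theta_form Om) (colv p.2 - theta_shift R k l m)).
Proof. by rewrite normcM normc_character mulr1. Qed.

Lemma theta_term_bound l Om : siegel Om ->
  exists C, forall p (B : {fset 'cV[int]_g}),
  cube g p.2 -> \sum_(m <- B) normc (theta_term l Om m p) <= C.
Proof.
move=> /re_posdef_theta_form/re_posdef_coercive[c c0 cM].
have pc : 0 < pi * c by rewrite mulr_gt0 ?pi_gt0.
have [C hC] := lattice_gauss_bound (k%:R^-1 *: intv R l) pc.
exists C => p B pB; apply: le_trans (hC (colv p.2) B _).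
  apply: ler_sum => m _; rewrite normc_theta_term.
  exact: normc_gauss_le.
by move=> i; have := pB i; rewrite mxE in_itv.
Qed.

Lemma Cmeasurable_theta_term l Om m : Cmeasurable setT (theta_term l Om m).
Proof.
apply: CmeasurableM.
  apply: Cmeasurable_gauss => i; under eq_fun do rewrite !mxE.
  apply: measurable_funB => //.
  exact: (measurableT_comp (measurable_tnth i) measurable_snd).
apply: Cmeasurable_character; apply: measurable_funM => //.
exact: (measurableT_comp (measurable_dot_colv _) measurable_fst).
Qed.

Definition exhaustion N : {fset 'cV[int]_g} :=
  [fset m in pmap choice.unpickle (iota 0 N)]%fset.

Lemma exhaustionP m : exists N0, forall N, (N0 <= N)%N -> m \in exhaustion N.
Proof.
exists (choice.pickle m).+1 => N mN; rewrite !inE mem_pmap -choice.pickleK map_f//.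
by rewrite mem_iota.
Qed.

(** The frequency of the character of x in the product of a term of one theta
    series with the conjugate of a term of another. *)
Definition frequency l l' m m' : 'cV[int]_g := k%:Z *: (m - m') + (l - l').

Lemma theta_term_mulJ l l' Om Om' m m' p :
  theta_term l Om m p * conjc (theta_term l' Om' m' p) =
  character (dot (intv R (frequency l l' m m')) (colv p.1)) *
  (gauss (theta_form Om) (colv p.2 - theta_shift R k l m) *
   conjc (gauss (theta_form Om') (colv p.2 - theta_shift R k l' m'))).
Proof.
rewrite /theta_term conjcM characterJ.
have -> : dot (intv R (frequency l l' m m')) (colv p.1) =
    k%:R * dot (theta_shift R k l m) (colv p.1)
    + - (k%:R * dot (theta_shift R k l' m') (colv p.1)).
  rewrite -mulrBr -[X in _ - X]mul1r -mulNr -!dotZl -dotDl -dotZl.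
  congr (dot _ _); apply/matrixP => i j; rewrite !mxE !rmorphD /= rmorphM /=.
  rewrite !rmorphN /=; field.
  by rewrite pnatr_eq0 -lt0n.
by rewrite characterD; ring.
Qed.

End theta_pairing.

Section theta_pairing_limit.
Context (R : realType) (g k : nat).
Hypothesis k0 : (0 < k)%N.
Local Notation leb := (lebesgue_tuple R).
Local Notation cube n := (@unit_cube R n).
Variables (Om Om' : 'M[R[i]]_g).
Hypotheses (hOm : siegel Om) (hOm' : siegel Om').
Implicit Types (l m : 'cV[int]_g).

Let W := theta_form k Om.
Let W' := theta_form k Om'.
Let Wp : re_posdef W := re_posdef_theta_form k0 hOm.
Let Wp' : re_posdef W' := re_posdef_theta_form k0 hOm'.

Let mCC : measurable (cube g `*` cube g).
Proof. by apply: measurableX; exact: measurable_unit_cube. Qed.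

Let muCC : ((leb g \x leb g)%E (cube g `*` cube g) < +oo)%E.
Proof.
rewrite product_measure1E; [|exact: measurable_unit_cube..].
by rewrite [X in (X * _)%E]lebesgue_unit_cube [X in (_ * X)%E]lebesgue_unit_cube
  mule1 ltry.
Qed.

Lemma normc_gauss_le1 (M : 'M[R[i]]_g) v : re_posdef M -> normc (gauss M v) <= 1.
Proof.
move=> /re_posdef_coercive[c c0 cM]; rewrite (le_trans (normc_gauss_le _ cM))//.
by rewrite -expR0 ler_expR oppr_le0 !mulr_ge0 ?pi_ge0 ?(ltW c0) ?dot_norm_ge0.
Qed.

Lemma Cmeasurable_gauss_sub (M : 'M[R[i]]_g) a :
  Cmeasurable setT (fun y : g.-tuple R => gauss M (colv y - a)).
Proof.
apply: Cmeasurable_gauss => i; under eq_fun do rewrite !mxE.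
by apply: measurable_funB => //; exact: measurable_tnth.
Qed.

Let G l l' m m' (y : g.-tuple R) : R[i] :=
  gauss W (colv y - theta_shift R k l m) *
  conjc (gauss W' (colv y - theta_shift R k l' m')).

Local Notation frequency := (frequency k).

Lemma theta_pair_integral l l' m m' :
  Cintegrable (leb g \x leb g)%E (cube g `*` cube g)
    (fun p => theta_term k l Om m p * conjc (theta_term k l' Om' m' p)) /\
  Cintegral (leb g \x leb g)%E (cube g `*` cube g)
    (fun p => theta_term k l Om m p * conjc (theta_term k l' Om' m' p)) =
  (frequency l l' m m' == 0)%:R * Cintegral (leb g) (cube g) (G l l' m m').
Proof.
rewrite (funext (theta_term_mulJ k0 l l' Om Om' m m')).
rewrite -Cintegral_character_cube.
apply: (@Cintegrable_prod _ _ _ _ R (leb g) (leb g) (fun x =>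
  character (dot (intv R (frequency l l' m m')) (colv x))) (G l l' m m'));
  try exact: measurable_unit_cube.
  apply: (@Cintegrable_cube _ _ _ 1) => [|x _]; last by rewrite normc_character.
  by apply: Cmeasurable_character; exact: measurable_dot_colv.
apply: (@Cintegrable_cube _ _ _ 1) => [|y _].
  apply: CmeasurableM; first exact: Cmeasurable_gauss_sub.
  by apply: CmeasurableJ; exact: Cmeasurable_gauss_sub.
rewrite normcM normc_conjc -[leRHS]mulr1.
by rewrite ler_pM ?normc_ge0 ?normc_gauss_le1.
Qed.

(** The partial sums over [exhaustion g N] of the two series are bounded on the
    cubes independently of [N], and their products integrate term by term. *)
Lemma L2_pairing_theta_limit l l' :
  Ccvg (fun N => \sum_(m <- exhaustion g N) \sum_(m' <- exhaustion g N)
    (frequency l l' m m' == 0)%:R * Cintegral (leb g) (cube g) (G l l' m m'))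
    (L2_pairing (theta k l Om) (theta k l' Om')).
Proof.
have [C hC] := theta_term_bound k0 l hOm.
have [C' hC'] := theta_term_bound k0 l' hOm'.
pose S N p : R[i] := \sum_(m <- exhaustion g N) theta_term k l Om m p.
pose S' N p : R[i] := \sum_(m <- exhaustion g N) theta_term k l' Om' m p.
have SS N p : S N p * conjc (S' N p) = \sum_(m <- exhaustion g N)
    \sum_(m' <- exhaustion g N)
    theta_term k l Om m p * conjc (theta_term k l' Om' m' p).
  by rewrite /S /S' conjc_sum big_distrlr.
have pref (x : R[i]) : complex.Re x = 0 -> expC x * conjc (expC x) = 1.
  move=> x0; rewrite expCJ -expCD -[RHS](expC0 R); congr expC.
  case: x x0 => a b /= ->.
  by apply: complex_ext; rewrite ?ReD ?ImD /=; ring.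
have L2E : L2_pairing (theta k l Om) (theta k l' Om') =
    Cintegral (leb g \x leb g)%E (cube g `*` cube g) (fun p =>
      Csum (fun m => theta_term k l Om m p) *
      conjc (Csum (fun m => theta_term k l' Om' m p))).
  apply: eq_Cintegral => p _.
  rewrite -[LHS]/(theta_fun k l Om (colv p.1) (colv p.2) *
    conjc (theta_fun k l' Om' (colv p.1) (colv p.2))).
  rewrite !theta_funE conjcM mulrACA pref ?mul1r//.
  rewrite -(rmorph_nat (real_complex R)) !(ReM, ImM, ReN) /=.
  by move: (@pi R) => q; ring.
rewrite L2E.
have [] := Cdominated_convergence (mu := (leb g \x leb g)%E) mCC
  (f_ := fun N p => S N p * conjc (S' N p))
  (f := fun p => Csum (fun m => theta_term k l Om m p) *
      conjc (Csum (fun m => theta_term k l' Om' m p))) (G := fun=> C * C').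
- move=> N.
  have mT : Cmeasurable setT (fun p => S N p * conjc (S' N p)).
    apply: CmeasurableM.
      by apply: Cmeasurable_sum => m; exact: Cmeasurable_theta_term.
    apply: CmeasurableJ.
    by apply: Cmeasurable_sum => m; exact: Cmeasurable_theta_term.
  by case: mT => m1 m2; split; apply: measurable_funTS.
- apply: measurable_bounded_integrable => //.
  by exists `|C * C'|; split => // x Kx y _ /=; rewrite ltW.
- move=> N p [_ p2]; rewrite normcM normc_conjc.
  apply: ler_pM; [exact: normc_ge0|exact: normc_ge0| |].
    exact: le_trans (normc_sum _ _ _) (hC _ _ p2).
  exact: le_trans (normc_sum _ _ _) (hC' _ _ p2).
- move=> p [_ p2]; apply: CcvgM.
    apply: (Csum_cvg (C := C)); last exact: exhaustionP.
    by move=> B; exact: hC.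
  apply: CcvgJ; apply: (Csum_cvg (C := C')); last exact: exhaustionP.
  by move=> B; exact: hC'.
move=> _; congr (Ccvg _ _); apply/funext => N.
under eq_Cintegral do rewrite SS.
have [|_ ->] := Cintegral_sum (mu := (leb g \x leb g)%E)
  (exhaustion g N) mCC
  (h := fun m p => \sum_(m' <- exhaustion g N)
    theta_term k l Om m p * conjc (theta_term k l' Om' m' p)).
  move=> m; apply: (Cintegral_sum _ _ _).1 => // m'.
  by have [] := theta_pair_integral l l' m m'.
apply: eq_bigr => m _.
have [|_ ->] := Cintegral_sum (mu := (leb g \x leb g)%E)
  (exhaustion g N) mCC
  (h := fun m' p => theta_term k l Om m p * conjc (theta_term k l' Om' m' p)).
  by move=> m'; have [] := theta_pair_integral l l' m m'.
by apply: eq_bigr => m' _; have [] := theta_pair_integral l l' m m'.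
Qed.

Lemma frequency_eq0 l m m' : (frequency l l m m' == 0) = (m' == m).
Proof.
rewrite /frequency subrr addr0; apply/eqP/eqP => [/matrixP e|->]; last first.
  by rewrite subrr scaler0.
apply/matrixP => i j; have /eqP := e i j.
by rewrite !mxE mulf_eq0 eqz_nat (gtn_eqF k0) subr_eq0 => /eqP.
Qed.

(** Only the pairs m' = m have frequency 0, and their Gaussians in y are the
    integer translates of a single one. *)
Lemma L2_pairing_theta_eq l :
  L2_pairing (theta k l Om) (theta k l Om') =
  Cintegral (leb g) setT
    (fun y => gauss (W + map_mx conjc W') (colv y - k%:R^-1 *: intv R l)).
Proof.
have lim := L2_pairing_theta_limit l l; apply: Ccvg_unique lim _.
pose H v := gauss (W + map_mx conjc W') (v - k%:R^-1 *: intv R l).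
have iH a : Cintegrable (leb g) setT (fun y => H (colv y + a)).
  have := Cintegrable_gauss (a - k%:R^-1 *: intv R l)
    (re_posdefD Wp (re_posdefJ Wp')) ltr01.
  by under eq_fun do rewrite scale1r addrA.
have := Cintegral_unfold (fun N => fset_uniq (exhaustion g N)) (@exhaustionP g) iH.
congr (Ccvg _ _); apply/funext => N; rewrite big_seq [RHS]big_seq.
apply: eq_bigr => m mN; rewrite (bigD1_seq m) ?fset_uniq//=.
rewrite frequency_eq0 eqxx mul1r big1 ?addr0 => [|m' /negPf mm']; last first.
  by rewrite frequency_eq0 mm' mul0r.
apply: eq_Cintegral => y _; rewrite /H /G gaussJ gaussD /theta_shift.
by rewrite opprD addrA.
Qed.

Lemma L2_pairing_theta_neq l l' :
  ~~ [forall i, (l i 0%R == l' i 0%R %[mod k])%Z] ->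
  L2_pairing (theta k l Om) (theta k l' Om') = 0.
Proof.
move=> /forallPn[i ll']; apply: Ccvg_unique (L2_pairing_theta_limit l l') _.
rewrite (_ : (fun N => _) = fun=> 0); first exact: Ccvg_cst.
apply/funext => N; rewrite big1// => m _; rewrite big1// => m' _.
rewrite (_ : _ == 0 = false) ?mul0r//; apply: contraNF ll'.
move=> /eqP/matrixP/(_ i 0); rewrite !mxE => /eqP; rewrite addr_eq0 => e.
rewrite eqz_mod_dvd; apply/dvdzP; exists (m' i 0 - m i 0).
by move/eqP : e; lra.
Qed.

End theta_pairing_limit.

Section theta_class.
Context (R : realType) (g k : nat).
Hypothesis k0 : (0 < k)%N.

Lemma theta_fun_mod (l a : 'cV[int]_g) (Om : 'M[R[i]]_g) x y :
  theta_fun k (l + k%:Z *: a) Om x y = theta_fun k l Om x y.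
Proof.
rewrite /theta_fun; congr (_ * _).
rewrite -[RHS](@Csum_reindex _ _ _ (+%R^~ a) (+%R^~ (- a))); last 2 first.
- by move=> m; rewrite addrK.
- by move=> m; rewrite subrK.
congr Csum; apply/funext => m /=.
suff -> : theta_shift R k (l + k%:Z *: a) m = theta_shift R k l (m + a) by [].
apply/matrixP => i j; rewrite !mxE !rmorphD /= rmorphM /=; field.
by rewrite pnatr_eq0 -lt0n.
Qed.

Lemma eq_mod_shift (l l' : 'cV[int]_g) :
  [forall i, (l i 0%R == l' i 0%R %[mod k])%Z] ->
  exists a : 'cV[int]_g, l' = l + k%:Z *: a.
Proof.
move=> /forallP ll'; exists (\col_i ((l' i 0%R - l i 0%R) %/ k)%Z).
apply/matrixP => i j; rewrite !ord1 !mxE mulrC divzK ?subrKC//.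
by rewrite -eqz_mod_dvd eq_sym.
Qed.

End theta_class.

(** * The half-form pairing *)

Section half_forms.
Context (R : realType) (g k : nat).
Hypothesis k0 : (0 < k)%N.
Variables (Om Om' : 'M[R[i]]_g).
Hypotheses (hOm : siegel Om) (hOm' : siegel Om').
Local Notation leb := (lebesgue_tuple R).

Let M := (2 * k%:R * 'i)^-1 *: (Om - map_mx conjc Om').
Let N := theta_form k Om + map_mx conjc (theta_form k Om').

(** The Gaussian of the L2 pairing against that of the half-form pairing. *)
Let NM : N = (2 * k%:R ^+ 2)%:C *: M.
Proof.
have kC : k%:R != 0 :> R[i] by rewrite pnatr_eq0 -lt0n.
have iC : 'i != 0 :> R[i].
  by apply/eqP => /(congr1 (@complex.Im R)) /= /eqP; rewrite oner_eq0.
have iJ : conjc 'i = - 'i :> R[i] by apply: complex_ext; rewrite //= oppr0.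
have ii : 'i * 'i = -1 :> R[i] by rewrite -expr2 sqr_i.
have iV : 'i^-1 = - 'i :> R[i].
  by apply: (mulfI iC); rewrite mulfV// mulrN ii opprK.
apply/matrixP => i j; rewrite !mxE !conjcM conjcN conjcM iJ conjc_nat.
rewrite !invfM iV realCM rmorphXn /= !rmorph_nat.
by field.
Qed.

Let Mp : re_posdef M.
Proof.
have [Ns Np] : re_posdef N.
  exact: re_posdefD (re_posdef_theta_form k0 hOm)
    (re_posdefJ (re_posdef_theta_form k0 hOm')).
have c0 : 0 < 2 * k%:R ^+ 2 :> R by rewrite mulr_gt0 ?exprn_gt0 ?ltr0n.
split.
  have cC : (2 * k%:R ^+ 2)%:C != 0 :> R[i].
    by apply/eqP => /(congr1 (@complex.Re R)) /= /eqP; rewrite gt_eqF.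
  have ME : M = (2 * k%:R ^+ 2)%:C^-1 *: N.
    by rewrite NM scalerA (mulVf cC) scale1r.
  by rewrite ME linearZ /= Ns.
move=> v /Np; rewrite NM quadZ ReM /= mul0r subr0.
by rewrite pmulr_rgt0.
Qed.

(** By the covariance in [gaussian_integralE], with dilation sqrt 2 k, the first
    factor is (sqrt 2 k)^(-g) times the Gaussian integral of [M], whose inverse
    is the second factor. *)
Lemma theta_gaussian_integral_mul_sqrt_det (u : 'cV[R]_g) :
  Cintegral (leb g) setT (fun y => gauss N (colv y - u)) * sqrt_det M =
  (2 `^ (- (g%:R / 2)) * k%:R ^- g)%:C.
Proof.
have [z zM zI] := gaussian_integralE Mp.
have z0 : z != 0.
  by apply: contra_eq_neq zM => ->; rewrite expr0n /= mul0r eq_sym oner_eq0.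
have gz : gaussian_integral M = z.
  have := zI 1 0 ltr01; rewrite expr1n invr1 mul1r => <-.
  by apply: eq_Cintegral => x _; rewrite scale1r addr0.
have [d2 dV] : [set d : R[i] | d ^+ 2 = \det M /\ d^-1 = gaussian_integral M]
    (sqrt_det M).
  apply: (@xgetPex _ 0); exists z^-1; split; last by rewrite invrK gz.
  by apply: (mulfI (expf_neq0 2 z0)); rewrite zM exprVn mulfV ?expf_neq0.
rewrite gz in dV.
have dE : sqrt_det M = z^-1 by rewrite -dV invrK.
pose r : R := Num.sqrt 2 * k%:R.
have r0 : 0 < r by rewrite mulr_gt0 ?sqrtr_gt0 ?ltr0n.
have -> : (fun y => gauss N (colv y - u)) =
    fun y => gauss M (r *: colv y + - (r *: u)).
  apply/funext => y; rewrite /gauss -scalerBr quad_scale_arg NM quadZ.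
  by rewrite exprMn sqr_sqrtr.
rewrite zI// dE mulfK//; congr (_%:C).
rewrite exprMn invfM; congr (_ * _).
by rewrite powRN [in RHS]mulrC powRrM powR12_sqrt// powR_mulrn// sqrtr_ge0.
Qed.

End half_forms.

Theorem theorem4p1 (R : realType) (g k : nat) (hg : (1 <= g)%N) (hk : (1 <= k)%N)
    (Om Om' : 'M[R[i]]_g) (hOm : siegel Om) (hOm' : siegel Om')
    (l l' : 'cV[int]_g) :
  BKS_pairing (theta k l Om, sqrt_dz Om) (theta k l' Om', sqrt_dz Om') =
  (2 `^ (- (g%:R / 2)) * k%:R ^- g)%:C
    * [forall i, (l i 0%R == l' i 0%R %[mod k])%Z]%:R.
Proof.
rewrite /BKS_pairing /half_form_pairing /=.
have [ll'|ll'] := boolP [forall i, (l i 0%R == l' i 0%R %[mod k])%Z]; last first.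
  by rewrite (L2_pairing_theta_neq hk hOm hOm' ll') mul0r mulr0.
have [a ->] := eq_mod_shift ll'.
have -> : L2_pairing (theta k l Om) (theta k (l + k%:Z *: a) Om') =
    L2_pairing (theta k l Om) (theta k l Om').
  by apply: eq_Cintegral => p _ /=; rewrite theta_fun_mod.
rewrite (L2_pairing_theta_eq hk hOm hOm').
rewrite mulr1 conjC1 !mul1r.
exact: (theta_gaussian_integral_mul_sqrt_det hk hOm hOm').
Qed.
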